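(* Let $b \geq 2$ and $k > 2b$ be integers and let $\mathcal A = \{A_1,\ldots,A_n\}$ be a family of subsets of $\mathbb R^2$ satisfying: (i) $f_{k+1}(\mathcal A) = 0$ (no $k+2$ distinct members of $\mathcal A$ have a common point); (ii) for each $\sigma\subseteq[n]$ with $|\sigma| \in \{k,k+1\}$, the set $A_\sigma$ is open (the empty set counting as open) and has at most $b$ path-connected components. Then $f_k(\mathcal A) \leq \frac{b}{k-2b}\, f^{\mathrm{ind}}_{k-1}(\mathcal A)$.
   Context: For a finite family $\mathcal A=\{A_1,\dots,A_n\}$ of sets and $\sigma\subseteq[n]=\{1,\dots,n\}$, write $A_\sigma=\bigcap_{i\in\sigma}A_i$. The nerve of $\mathcal A$ is $N(\mathcal A)=\{\sigma\subseteq[n]: A_\sigma\neq\emptyset\}$. For $k\ge 0$, $f_k(\mathcal A)=|\{\sigma\in N(\mathcal A): |\sigma|=k+1\}|$, and $f^{\mathrm{ind}}_k(\mathcal A)=|\{\tau\in N(\mathcal A): |\tau|=k+1 \text{ and there is } \sigma\in N(\mathcal A) \text{ with } \sigma\supset\tau,\ |\sigma|=k+2\}|$. *)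

(* Defs.v *)
From mathcomp Require Import all_boot all_order all_algebra.
From mathcomp Require Import all_classical all_reals all_analysis.

Set Implicit Arguments.
Unset Strict Implicit.
Unset Printing Implicit Defensive.

Import Order.TTheory GRing.Theory Num.Theory.
Import numFieldNormedType.Exports.

Local Open Scope classical_set_scope.
Local Open Scope ring_scope.

Section nerve.
Context {T : Type} {n : nat}.
Implicit Types (A : 'I_n -> set T) (s t : {set 'I_n}) (k : nat).

(* The empty intersection is the whole ambient type [T]. *)
Definition inter A s : set T := \bigcap_(i in [set` s]) A i.

Definition nerve A : {set {set 'I_n}} :=
  [set s : {set 'I_n} | `[< inter A s !=set0 >]]%SET.

Definition fnum k A : nat :=
  #|[set s in nerve A | #|s| == k.+1]%SET|.

Definition fnum_ind k A : nat :=
  #|[set t in nerve A | (#|t| == k.+1) &&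
      [exists s in nerve A, (t \subset s) && (#|s| == k.+2)]]%SET|.

End nerve.

Section path_components.
Context (R : realType) {T : topologicalType}.
Implicit Types (A : set T) (x y : T).

(* Only the values of [g] on [0, 1] matter. *)
Definition path_joined A x y : Prop :=
  exists g : R -> T,
    [/\ {within `[0, 1], continuous g}, g 0 = x, g 1 = y &
        g @` `[0, 1] `<=` A].

Definition path_component A x : set T := [set y | path_joined A x y].

Definition path_components A : set (set T) := path_component A @` A.

End path_components.

(* Main.v *)
(** Call two points of an open set equivalent when a chain of open squares
    inside the set joins them; the classes are at most as many as the path
    components. Let V be the classes of the A_s with |s| = k+1 and W those of
    the A_t with |t| = k and t contained in a (k+1)-set of the nerve. By (i) the
    classes in V are pairwise disjoint and classes in W meet only inside them.
    On a fine enough grid, compactness gives finite connected sets of grid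
    points that realise this pattern; contracting a class of V to a vertex and
    distributing the remaining grid points of each class of W among the
    vertices it contains gives a minor of the grid, in which the vertices
    contained in any class of W induce a connected graph. Its number of edges is
    at most 3|V|, by a Mac Lane type argument over F_2: cycles are boundaries of
    sets of grid squares, so the cycle space is spanned by cycles of length at
    least 3 that cover every edge at most twice. Counting one spanning tree per
    class of W gives at least k f_k + |V| - |W| edges, hence
    k f_k <= 2|V| + |W| <= 2b f_k + b f_ind. *)

Require Import Defs.
From mathcomp Require Import all_boot all_order all_algebra.
From mathcomp Require Import all_classical all_reals all_analysis.
From mathcomp Require Import ring lra zify.

Import Order.TTheory GRing.Theory Num.Theory.
Import numFieldNormedType.Exports.

Local Open Scope classical_set_scope.
Local Open Scope ring_scope.

(** * Connectivity in the square grid *)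

(** An edge is coded by its left or lower endpoint and a direction, [true] for vertical, so each
    undirected edge has exactly one code. *)
Definition edge_tgt (e : int * int * bool) : int * int :=
  if e.2 then (e.1.1, e.1.2 + 1) else (e.1.1 + 1, e.1.2).

Definition grid_adj (p q : int * int) : Prop :=
  exists e : int * int * bool,
    (e.1 = p /\ edge_tgt e = q) \/ (e.1 = q /\ edge_tgt e = p).

Inductive grid_conn (X : int * int -> Prop) (p : int * int) :
    int * int -> Prop :=
| grid_conn_refl : X p -> grid_conn X p p
| grid_conn_step q r :
    grid_conn X p q -> grid_adj q r -> X r -> grid_conn X p r.

Lemma grid_adj_sym p q : grid_adj p q -> grid_adj q p.
Proof. by case=> e [[]|[]]; exists e; [right|left]. Qed.

Lemma grid_conn_left X p q : grid_conn X p q -> X p.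
Proof. by elim. Qed.

Lemma grid_conn_right X p q : grid_conn X p q -> X q.
Proof. by case. Qed.

Lemma grid_conn_trans X p q r :
  grid_conn X p q -> grid_conn X q r -> grid_conn X p r.
Proof.
by move=> pq; elim=> // s t _ ps st Xt; exact: grid_conn_step ps st Xt.
Qed.

Lemma grid_conn_sym X p q : grid_conn X p q -> grid_conn X q p.
Proof.
elim=> [Xp|s t ps sp st Xt]; first exact: grid_conn_refl.
apply: grid_conn_trans sp; apply: (@grid_conn_step _ _ t).
- exact: grid_conn_refl.
- exact: grid_adj_sym.
- exact: grid_conn_right ps.
Qed.

Lemma grid_conn_sub (X Y : int * int -> Prop) p q :
  (forall z, X z -> Y z) -> grid_conn X p q -> grid_conn Y p q.
Proof.
move=> XY; elim=> [Xp|s t _ ps st Xt]; first by apply/grid_conn_refl/XY.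
by apply: grid_conn_step ps st _; exact: XY.
Qed.

Lemma grid_conn_cut (X Z : int * int -> Prop) p q :
  grid_conn X p q -> Z p -> ~ Z q ->
  exists a b, [/\ X a, X b, grid_adj a b & Z a /\ ~ Z b].
Proof.
move=> + Zp; elim=> // s t ps IH st Xt nZt.
have [Zs|nZs] := EM (Z s); last exact: IH.
by exists s, t; split=> //; exact: grid_conn_right ps.
Qed.

(** Collect the points of one walk from [p] to each member of [l]; all these walks share [p]. *)
Lemma grid_conn_finite (X : int * int -> Prop) p (l : seq (int * int)) :
  X p -> (forall z, z \in l -> grid_conn X p z) ->
  exists s : seq (int * int),
    [/\ p \in s, {subset l <= s}, forall z, z \in s -> X z &
        forall z, z \in s -> grid_conn (fun y => y \in s) p z].
Proof.
move=> Xp; elim: l => [_|q l IH Hl].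
  exists [:: p]; split=> [||z|z]; rewrite ?mem_seq1 //; first by move/eqP->.
  by move/eqP->; apply: grid_conn_refl; rewrite mem_seq1.
have [z zl|s [ps ls sX sc]] := IH; first by apply: Hl; rewrite inE zl orbT.
have [t [pt qt tX tc]] : exists t : seq (int * int),
    [/\ p \in t, q \in t, forall z, z \in t -> X z &
        forall z, z \in t -> grid_conn (fun y => y \in t) p z].
  have : grid_conn X p q by apply: Hl; rewrite mem_head.
  elim=> [_|a b pa [t [pt qt tX tc]] ab Xb].
    exists [:: p]; split=> [||z|z]; rewrite ?mem_seq1 //; first by move/eqP->.
    by move/eqP->; apply: grid_conn_refl; rewrite mem_seq1.
  have sub z : z \in t -> z \in b :: t by rewrite inE orbC => ->.
  exists (b :: t); split; rewrite ?inE ?pt ?eqxx ?orbT //.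
    by move=> z; rewrite inE => /orP[/eqP->|/tX].
  move=> z; rewrite inE => /orP[/eqP->|/tc]; last exact: grid_conn_sub.
  apply: (@grid_conn_step _ _ a) => //; last by rewrite mem_head.
  by apply: grid_conn_sub (tc _ qt).
exists (s ++ t); split.
- by rewrite mem_cat ps.
- move=> z; rewrite inE mem_cat => /orP[/eqP->|/ls->//]; by rewrite qt orbT.
- by move=> z; rewrite mem_cat => /orP[/sX|/tX].
- move=> z; rewrite mem_cat => /orP[/sc|/tc]; apply: grid_conn_sub => y ys;
  by rewrite mem_cat ys ?orbT.
Qed.

(** * Mod 2 chains on the grid and their potentials *)

Lemma F2_addrr (x : 'F_2) : x + x = 0.
Proof. by case: x => [[|[|//]] Hx]; apply/val_inj. Qed.

Lemma F2_neq0 (x : 'F_2) : x != 0 -> x = 1.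
Proof. by case: x => [[|[|//]] Hx] // _; apply/val_inj. Qed.

Lemma F2_addr_eq0 (x y : 'F_2) : (x + y == 0) = (x == y).
Proof. by case: x y => [[|[|//]] Hx] [[|[|//]] Hy]. Qed.

(** Unit squares are named by their lower left corner. [edge_rsq] and [edge_lsq] are the squares on
    the two sides of an edge: right and left of a vertical one, above and below a horizontal one. *)
Definition edge_rsq (e : int * int * bool) : int * int := e.1.

Definition edge_lsq (e : int * int * bool) : int * int :=
  if e.2 then (e.1.1 - 1, e.1.2) else (e.1.1, e.1.2 - 1).

Definition edge_star (p : int * int) : seq (int * int * bool) :=
  [:: (p, false); ((p.1 - 1, p.2), false); (p, true); ((p.1, p.2 - 1), true)].

Definition chain_bd (c : int * int * bool -> 'F_2) (p : int * int) : 'F_2 :=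
  \sum_(e <- edge_star p) c e.

Lemma edge_tgt_neq e : (edge_tgt e == e.1) = false.
Proof.
by case: e => [[i j] []]; rewrite /edge_tgt /= xpair_eqE; lia.
Qed.

Lemma mem_edge_star e p : (e \in edge_star p) = (p == e.1) || (p == edge_tgt e).
Proof.
case: e => [[i j] []]; case: p => [x y];
by rewrite !inE /edge_tgt /= !xpair_eqE /= ?andbT ?andbF; lia.
Qed.

Lemma uniq_edge_star p : uniq (edge_star p).
Proof. by case: p => [x y]; rewrite /= !inE !xpair_eqE /=; lia. Qed.

Lemma mem_edge_starE e p :
  (e \in edge_star p)%:R = (p == e.1)%:R + (p == edge_tgt e)%:R :> 'F_2.
Proof.
rewrite mem_edge_star; case: (p =P e.1) => [->|_] /=; last by rewrite add0r.
by rewrite eq_sym edge_tgt_neq addr0.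
Qed.

Lemma sum_seq_pick (I : eqType) (s : seq I) (q : I) (f : I -> 'F_2) :
  uniq s -> q \in s -> \sum_(p <- s) (p == q)%:R * f p = f q.
Proof.
move=> us qs; rewrite (bigD1_seq q) //= eqxx mul1r big1 ?addr0 // => i /negbTE ->.
by rewrite mul0r.
Qed.

(** A finite edge list common to many points allows sums over points and edges to be exchanged. *)
Lemma chain_bdE (F : seq (int * int * bool)) c p :
  uniq F -> {subset edge_star p <= F} ->
  chain_bd c p = \sum_(e <- F) c e * ((p == e.1)%:R + (p == edge_tgt e)%:R).
Proof.
move=> uF sF.
transitivity (\sum_(e <- F | e \in edge_star p) c e); last first.
  rewrite big_mkcond; apply: eq_bigr => e _.
  by rewrite -mem_edge_starE; case: ifP; rewrite ?mulr1 ?mulr0.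
rewrite /chain_bd -[RHS]big_filter; apply: perm_big; apply: uniq_perm.
- exact: uniq_edge_star.
- exact: filter_uniq.
- by move=> e; rewrite mem_filter; case: (boolP (e \in edge_star p)) => // /sF ->.
Qed.

(** Partial sums from 0 in both directions; over ['F_2] the negative side needs no sign. *)
Lemma int_antiderivative (f : int -> 'F_2) :
  exists F : int -> 'F_2, F 0 = 0 /\ forall i, F (i + 1) = F i + f i.
Proof.
exists (fun i => match i with
  | Posz n => \sum_(k < n) f (Posz k)
  | Negz n => \sum_(k < n.+1) f (Negz k) end); split; first exact: big_ord0.
case=> n.
  have -> : (Posz n + 1)%R = Posz n.+1 by rewrite -addn1 PoszD.
  by rewrite big_ord_recr.
case: n => [|n].
  have -> : (Negz 0 + 1)%R = Posz 0 by [].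
  by rewrite /= big_ord0 big_ord_recr big_ord0 /= add0r F2_addrr.
have -> : (Negz n.+1 + 1)%R = Negz n by lia.
by rewrite [in RHS]big_ord_recr /= -addrA F2_addrr addr0.
Qed.

Lemma int_ind_const (f : int -> 'F_2) :
  (forall i, f (i + 1) = f i) -> forall i, f i = f 0.
Proof.
move=> fS; case; elim=> [//|n IH].
- rewrite -IH -(fS (Posz n)); congr f; lia.
- by have := fS (Negz 0) => <-.
- by have -> : f (Negz n.+1) = f (Negz n);
  [have := fS (Negz n.+1) => <-; congr f; lia|].
Qed.

(* Path integration: up from the axis inside a column of squares. *)
Lemma cycle_is_boundary (c : int * int * bool -> 'F_2) :
  (forall p, chain_bd c p = 0) ->
  exists phi : int * int -> 'F_2,
    forall e, c e = phi (edge_rsq e) + phi (edge_lsq e).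
Proof.
move=> c0.
have /choice[F HF] : forall i : int, exists F : int -> 'F_2, F 0 = 0 /\
    forall j, F (j + 1) = F j + c ((i, j + 1), false).
  by move=> i; exact: int_antiderivative (fun j => c ((i, j + 1), false)).
(* [G] integrates along the squares at height 0; the potential of the square [(i, j)] will be
   [G i + F i j]. *)
have [G [_ GS]] := int_antiderivative (fun i => c ((i + 1, 0), true)).
have FS i j : F i j = F i (j - 1) + c ((i, j), false).
  by have := (HF i).2 (j - 1); rewrite subrK.
have vert i j : c ((i, j), true) = G i + F i j + (G (i - 1) + F (i - 1) j).
  apply/eqP; rewrite -F2_addr_eq0; apply/eqP.
  (* [psi] is the error of the formula at height [j]. The cycle condition at [(i, k + 1)] makes it
     constant, and the choice of [G] makes it vanish at height 0. *)
  set psi := fun j => c ((i, j), true) + (G i + F i j + (G (i - 1) + F (i - 1) j)).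
  have psiS k : psi (k + 1) = psi k.
    apply/eqP; rewrite -F2_addr_eq0 -(c0 (i, k + 1)) /chain_bd /psi !big_cons big_nil.
    rewrite (FS i (k + 1)) (FS (i - 1) (k + 1)) /= addrK.
    set a := c _; set b := c _; set d := c _; set e := c _; set x := G i.
    set y := G _; set u := F _ _; set v := F _ _.
    have -> : a + (x + (u + b) + (y + (v + d))) + (e + (x + u + (y + v))) =
       (b + (d + (a + (e + 0)))) + ((x + x) + (u + u) + (y + y) + (v + v)) by ring.
    by rewrite !F2_addrr !addr0.
  rewrite -/(psi j) (int_ind_const psi psiS) /psi (HF i).1 (HF (i - 1)).1 !addr0.
  by have := GS (i - 1); rewrite subrK => ->; rewrite addrAC F2_addrr add0r F2_addrr.
exists (fun p => G p.1 + F p.1 p.2) => -[[i j] []]; rewrite /edge_rsq /edge_lsq //=.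
rewrite (FS i j); set x := G i; set y := F _ _; set z := c _.
have -> : x + (y + z) + (x + y) = z + (x + x) + (y + y) by ring.
by rewrite !F2_addrr !addr0.
Qed.

(** * Edge bound for simple minors of the grid *)

Section PlanarBound.
(** [l] sends a grid point to the vertex of the minor into which it is contracted, [None] meaning
    deleted; [eps y] is a grid edge representing the edge [y] of the minor. The list [dom] makes the
    label classes finite. *)
Variables (V Y : finType) (l : int * int -> option V) (dom : seq (int * int)).
Variables (eps : Y -> int * int * bool) (a b : Y -> V).
Hypothesis l_dom : forall p, l p != None -> p \in dom.
Hypothesis l_conn : forall v p q, l p = Some v -> l q = Some v ->
  grid_conn (fun z => l z = Some v) p q.
Hypothesis l_src : forall y, l (eps y).1 = Some (a y).
Hypothesis l_tgt : forall y, l (edge_tgt (eps y)) = Some (b y).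
Hypothesis ab_neq : forall y, a y != b y.
Hypothesis ab_simple : forall y y',
  a y = a y' /\ b y = b y' \/ a y = b y' /\ b y = a y' -> y = y'.

Let inner (e : int * int * bool) : Prop :=
  l e.1 != None /\ l e.1 = l (edge_tgt e).

Let inc (v : V) (y : Y) : 'F_2 := (a y == v)%:R + (b y == v)%:R.

Let cyc (c : Y -> 'F_2) : Prop := forall v, \sum_y c y * inc v y = 0.

(** Potentials on squares that change only across edges of the subgraph formed by the inner and the
    chosen edges, that is, functions constant on its faces. *)
Let adm (phi : int * int -> 'F_2) : Prop := forall e,
  phi (edge_rsq e) + phi (edge_lsq e) != 0 -> inner e \/ exists y, e = eps y.

Let jump (phi : int * int -> 'F_2) (y : Y) : 'F_2 :=
  phi (edge_rsq (eps y)) + phi (edge_lsq (eps y)).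

Let eps_inj : injective eps.
Proof.
move=> y y' e; apply: ab_simple; left.
have := l_src y; rewrite e l_src => -[->].
by have := l_tgt y; rewrite e l_tgt => -[->].
Qed.

Let eps_inner y : ~ inner (eps y).
Proof. by case=> _; rewrite l_src l_tgt => -[/eqP]; exact/negP. Qed.

Let edge_delta (f e : int * int * bool) : 'F_2 := (e == f)%:R.

Let bd_delta f p :
  chain_bd (edge_delta f) p = (p == f.1)%:R + (p == edge_tgt f)%:R.
Proof.
rewrite -mem_edge_starE /chain_bd /edge_delta.
have [fp|fp] := boolP (f \in edge_star p).
  rewrite (bigD1_seq f) ?uniq_edge_star //= eqxx big1 ?addr0 // => i /negbTE ->//.
by rewrite big_seq big1 // => i ip; case: eqP => // ei; rewrite -ei ip in fp.
Qed.

Let bdD c c' p : chain_bd (fun e => c e + c' e) p = chain_bd c p + chain_bd c' p.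
Proof. by rewrite /chain_bd big_split. Qed.

(** Add up the edges of the walk: intermediate points are counted twice and cancel. *)
Let path_chain v p q : grid_conn (fun z => l z = Some v) p q ->
  exists c, (forall r, chain_bd c r = (r == p)%:R + (r == q)%:R) /\
    forall e, c e != 0 -> inner e.
Proof.
elim=> [_|s t ps [c [cb ci]] [e He] lt].
  exists (fun=> 0); split=> [r|e]; last by rewrite eqxx.
  by rewrite F2_addrr /chain_bd big1.
exists (fun f => c f + edge_delta e f); split=> [r|f].
  rewrite bdD cb bd_delta -addrA; congr (_ + _).
  have -> : (r == e.1)%:R + (r == edge_tgt e)%:R = (r == s)%:R + (r == t)%:R :> 'F_2.
    by case: He => -[-> ->] //; rewrite addrC.
  by rewrite addrA F2_addrr add0r.
rewrite /edge_delta; case: (f =P e) => [-> _|_]; last by rewrite addr0; exact: ci.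
have ls := grid_conn_right _ _ _ ps.
by rewrite /inner; case: He => -[-> ->]; rewrite ls lt.
Qed.

Let root (v : V) : int * int := xget (0, 0) [set p | l p = Some v].

Let rootP p v : l p = Some v -> l (root v) = Some v.
Proof. by move=> lp; apply: (@xgetPex _ (0, 0) [set p | l p = Some v]); exists p. Qed.

(** A cycle of the minor becomes a cycle of the grid once both ends of each of its edges are joined
    to the roots of their label classes by inner paths; a potential of this grid cycle is the
    required function. *)
Let lift c : cyc c -> exists phi, adm phi /\ forall y, jump phi y = c y.
Proof.
move=> cc.
have /choice[P HP] : forall p : int * int, exists P, forall v, l p = Some v ->
    (forall r, chain_bd P r = (r == p)%:R + (r == root v)%:R) /\
    forall e, P e != 0 -> inner e.
  move=> p; case pv: (l p) => [v|]; last by exists (fun=> 0).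
  have [P HP] := path_chain v p (root v) (l_conn _ _ _ pv (rootP _ _ pv)).
  by exists P => _ [<-].
pose T y e := edge_delta (eps y) e + (P (eps y).1 e + P (edge_tgt (eps y)) e).
pose C e := \sum_y c y * T y e.
have C_inner e : ~ inner e -> C e = \sum_y c y * edge_delta (eps y) e.
  move=> ne; apply: eq_bigr => y _; congr (_ * _); rewrite /T.
  have /eqP -> : P (eps y).1 e == 0.
    by apply/negP => /negP /((HP _ _ (l_src y)).2 e).
  have /eqP -> : P (edge_tgt (eps y)) e == 0.
    by apply/negP => /negP /((HP _ _ (l_tgt y)).2 e).
  by rewrite !addr0.
have bdC p : chain_bd C p = 0.
  rewrite /chain_bd /C exchange_big /=.
  transitivity (\sum_y c y * ((p == root (a y))%:R + (p == root (b y))%:R)).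
    apply: eq_bigr => y _; rewrite -mulr_sumr; congr (_ * _).
    rewrite -/(chain_bd (T y) p) /T !bdD bd_delta.
    rewrite (HP _ _ (l_src y)).1 (HP _ _ (l_tgt y)).1.
    set A := (p == _)%:R; set B := (p == _)%:R; set A' := (p == _)%:R.
    set B' := (p == _)%:R.
    have -> : A + B + (A + A' + (B + B')) = (A + A) + (B + B) + (A' + B') by ring.
    by rewrite !F2_addrr !add0r.
  have ra y := rootP _ _ (l_src y); have rb y := rootP _ _ (l_tgt y).
  (* At the root of [v] the boundary is the cycle condition of [c] at [v]; at all other points every
     term is zero. *)
  case: (EM (exists v, l p = Some v /\ p = root v)) => [[v [lp pv]]|np].
    apply: etrans (cc v); apply: eq_bigr => y _; rewrite /inc; congr (_ * (_%:R + _%:R)).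
      by congr nat_of_bool; apply/eqP/eqP => [pa|->//]; move: (ra y); rewrite -pa lp => -[].
    by congr nat_of_bool; apply/eqP/eqP => [pb|->//]; move: (rb y); rewrite -pb lp => -[].
  rewrite big1 // => y _; case: eqP => [pa|_].
    by case: np; exists (a y); rewrite {1}pa ra.
  case: eqP => [pb|_]; last by rewrite addr0 mulr0.
  by case: np; exists (b y); rewrite {1}pb rb.
have [phi Hphi] := cycle_is_boundary C bdC.
exists phi; split=> [e|y]; last first.
  rewrite /jump -Hphi C_inner; last exact: eps_inner.
  rewrite /edge_delta (bigD1 y) //= eqxx mulr1 big1 ?addr0 // => z zy.
  by rewrite (inj_eq eps_inj) eq_sym (negbTE zy) mulr0.
rewrite -Hphi => Ce; have [|ne] := EM (inner e); [by left|right].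
apply: contrapT => ny; move: Ce; rewrite C_inner // big1 ?eqxx // => y _.
by rewrite /edge_delta; case: eqP => [ey|]; [case: ny; exists y|rewrite mulr0].
Qed.

(* Summing the boundary of a boundary over a label class: inner edges are
   counted twice, hence only the chosen edges survive. *)
Let jump_cyc phi : adm phi -> cyc (jump phi).
Proof.
move=> Aphi v; pose s := undup dom.
pose F := undup (flatten [seq edge_star p | p <- s]).
have uF : uniq F by exact: undup_uniq.
have starF p : p \in s -> {subset edge_star p <= F}.
  by move=> ps e ep; rewrite mem_undup; apply/flattenP; exists (edge_star p) => //; apply: map_f.
pose c e := phi (edge_rsq e) + phi (edge_lsq e).
have bdc p : chain_bd c p = 0.
  rewrite /chain_bd !big_cons big_nil /c /edge_rsq /edge_lsq /=.
  case: p => i j /=.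
  set x := phi _; set y := phi _; set z := phi _; set w := phi _.
  have -> : x + y + (z + w + (x + z + (y + w + 0))) =
    (x + x) + (y + y) + (z + z) + (w + w) by ring.
  by rewrite !F2_addrr.
pose lab p : 'F_2 := (l p == Some v)%:R.
have labs p : lab p != 0 -> p \in s.
  rewrite /lab mem_undup; case: (l p =P Some v) => [pv _|_]; last by rewrite eqxx.
  by apply: l_dom; rewrite pv.
have pick q : \sum_(p <- s) lab p * (p == q)%:R = lab q.
  have [qs|qs] := boolP (q \in s).
    under eq_bigr do rewrite mulrC.
    by rewrite (@sum_seq_pick _ s q lab) ?undup_uniq.
  have -> : lab q = 0 by apply/eqP/negP => /negP /labs; apply/negP.
  rewrite big_seq big1 // => p ps; case: eqP => [pq|]; last by rewrite mulr0.
  by rewrite -pq ps in qs.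
have : \sum_(p <- s) lab p * chain_bd c p = 0.
  by rewrite big1 // => p _; rewrite bdc mulr0.
pose g e := c e * (lab e.1 + lab (edge_tgt e)).
have -> : \sum_(p <- s) lab p * chain_bd c p = \sum_(e <- F) g e.
  transitivity (\sum_(p <- s) \sum_(e <- F)
      lab p * (c e * ((p == e.1)%:R + (p == edge_tgt e)%:R))).
    rewrite big_seq [RHS]big_seq; apply: eq_bigr => p ps.
    by rewrite (chain_bdE F) ?mulr_sumr //; exact: starF.
  rewrite exchange_big /=; apply: eq_bigr => e _.
  rewrite /g -(pick e.1) -(pick (edge_tgt e)) -big_split mulr_sumr /=.
  by apply: eq_bigr => p _; ring.
(* Off the chosen edges, either [c e] vanishes by admissibility or both ends carry the same
   label. *)
have gE e : g e = \sum_y (e == eps y)%:R * g e.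
  have [[y ->]|ny] := EM (exists y, e = eps y).
    rewrite (bigD1 y) //= eqxx mul1r big1 ?addr0 // => z zy.
    by rewrite (inj_eq eps_inj) eq_sym (negbTE zy) mul0r.
  rewrite big1 => [|y _]; last first.
    by case: eqP => [ey|]; [case: ny; exists y|rewrite mul0r].
  rewrite /g; case: (eqVneq (c e) 0) => [->|/Aphi[[_ ie]|//]]; first by rewrite mul0r.
  by rewrite /lab ie F2_addrr mulr0.
rewrite (eq_bigr _ (fun e _ => gE e)) exchange_big /= => E; apply: etrans E; apply: eq_bigr => y _.
rewrite sum_seq_pick //; last first.
  apply: (starF (eps y).1); last by rewrite mem_edge_star eqxx.
  by rewrite mem_undup; apply: l_dom; rewrite l_src.
by rewrite /g /lab l_src l_tgt /inc /jump /c.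
Qed.

(** At each end of [y0] the cycle condition forces another edge of the support. The two edges so
    found differ, since a single edge through both ends would be parallel to [y0]. *)
Let cyc_weight w y0 : cyc w -> w y0 != 0 -> (3 <= #|[set y | w y != 0%R]%SET|)%N.
Proof.
move=> cw w0.
have other v : (a y0 == v) || (b y0 == v) ->
    exists2 y, y != y0 & (w y != 0) && ((a y == v) || (b y == v)).
  move=> y0v; apply: contrapT => no.
  have := cw v; rewrite (bigD1 y0) //= big1 => [|y yy0].
    rewrite addr0 (F2_neq0 _ w0) mul1r /inc; have := ab_neq y0.
    case/orP: y0v => /eqP <-; rewrite eqxx 1?eq_sym => /negbTE -> /eqP.
      by rewrite addr0 oner_eq0.
    by rewrite add0r oner_eq0.
  case: (eqVneq (w y) 0) => [->|wy]; first by rewrite mul0r.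
  rewrite /inc; case: eqP => [av|_].
    by case: no; exists y; rewrite ?wy ?av ?eqxx.
  case: eqP => [bv|_]; last by rewrite addr0 mulr0.
  by case: no; exists y; rewrite ?wy ?bv ?eqxx ?orbT.
have [|y1 y10 /andP[w1 v1]] := other (a y0); first by rewrite eqxx.
have [|y2 y20 /andP[w2 v2]] := other (b y0); first by rewrite eqxx orbT.
have y12 : y1 != y2.
  apply/eqP => y12; subst y2; case/negP: y10; apply/eqP/ab_simple.
  have := ab_neq y0.
  case/orP: v1 => /eqP e1; case/orP: v2 => /eqP e2; rewrite -?e1 -?e2 ?eqxx //;
    by [left|right].
have <- : #|[set y0; y1; y2]%SET| = 3%N.
  by rewrite -finset.setUA cardsU1 cards2 !inE y12 negb_or eq_sym y10 eq_sym y20.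
apply/subset_leq_card/fintype.subsetP => y; rewrite !inE.
by case/orP => [/orP[]|] /eqP ->.
Qed.

(* Two squares lie in the same face when no admissible function separates
   them; the faces generate the cycle space, each is a cycle of weight at
   least 3, and each edge borders at most two of them. *)
Lemma grid_minor_edge_bound : (#|Y| <= 3 * #|V|)%N.
Proof.
pose rep s := xget (0, 0) [set s' | forall phi, adm phi -> phi s = phi s'].
have repP s phi : adm phi -> phi s = phi (rep s).
  by apply: (@xgetPex _ (0, 0) [set s' | forall phi, adm phi -> phi s = phi s']); exists s.
have rep_eq s s' : (forall phi, adm phi -> phi s = phi s') -> rep s = rep s'.
  move=> ss; congr xget; apply/seteqP.
  by split=> t /= h phi ap; rewrite -h // ss.
pose w f (y : Y) : 'F_2 := (rep (edge_rsq (eps y)) == f)%:R + (rep (edge_lsq (eps y)) == f)%:R.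
have w_cyc f : cyc (w f).
  pose face s : 'F_2 := (rep s == f)%:R.
  apply: (jump_cyc face) => e; rewrite /face.
  case: (eqVneq (rep (edge_rsq e)) (rep (edge_lsq e))) => [->|ne _].
    by rewrite F2_addrr eqxx.
  apply: contrapT => ni; case/eqP: ne; apply: rep_eq => phi ap.
  apply/eqP; rewrite -F2_addr_eq0; apply/negP => /negP h; exact: ni (ap _ h).
(* Faces with a zero vector are discarded, because the weight bound 3 applies only to nonzero
   cycles. *)
pose F := [seq f <- undup ([seq rep (edge_rsq (eps y)) | y <- enum Y] ++
          [seq rep (edge_lsq (eps y)) | y <- enum Y]) | [exists y, w f y != 0]].
have uF : uniq F by rewrite filter_uniq // undup_uniq.
pose m := size F.
have m_le : (3 * m <= 2 * #|Y|)%N.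
  have h3 : (\sum_(f <- F) 3 <= \sum_(f <- F) \sum_y (w f y != 0%R))%N.
    rewrite big_seq [leqRHS]big_seq; apply: leq_sum => f.
    rewrite mem_filter => /andP[/existsP[y wy] _].
    have := cyc_weight _ _ (w_cyc f) wy; rewrite -sum1dep_card.
    by rewrite big_mkcond.
  have h2 : (\sum_(f <- F) \sum_y (w f y != 0%R) <= \sum_(y : Y) 2)%N.
    rewrite exchange_big /=; apply: leq_sum => y _.
    apply: (@leq_trans (\sum_(f <- F)
        ((f == rep (edge_rsq (eps y))) + (f == rep (edge_lsq (eps y)))))%N).
      apply: leq_sum => f _; rewrite /w !(eq_sym f).
      by case: (rep _ == f); case: (rep _ == f); rewrite ?addr0 ?eqxx ?leq_b1.
    rewrite big_split /=; apply: (@leq_add _ _ 1 1);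
      rewrite -(big_mkcond (fun f => f == _)) sum1_count count_uniq_mem //; exact: leq_b1.
  move: (leq_trans h3 h2); rewrite big_const_seq iter_addn_0 count_predT sum_nat_const.
  by rewrite -/m mulnC [X in (_ <= X)%N]mulnC.
(* The left kernel of the incidence matrix [B] is the cycle space; the rows of [W] are the face
   vectors. *)
pose B : 'M['F_2]_(#|Y|, #|V|) := \matrix_(i, j) inc (enum_val j) (enum_val i).
pose W : 'M['F_2]_(m, #|Y|) := \matrix_(i, j) w (nth (0, 0) F i) (enum_val j).
have kerW : (kermx B <= W)%MS.
  apply/row_subP => i.
  have : row i (kermx B) *m B = 0 by rewrite -row_mul mulmx_ker row0.
  move: (row i _) => r rB.
  pose c y := r ord0 (enum_rank y).
  have cc : cyc c.
    move=> v; have := congr1 (fun M : 'rV__ => M ord0 (enum_rank v)) rB.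
    rewrite !mxE => E; apply: etrans E.
    rewrite [RHS](reindex (@enum_rank Y)) /=; last by apply: onW_bij; exact: enum_rank_bij.
    by apply: eq_bigr => y _; rewrite mxE !enum_rankK.
  have [phi [ap pc]] := lift c cc.
  (* An admissible potential is constant on faces, so its values at the face representatives serve
     as coefficients. *)
  apply/submxP; exists (\row_i phi (nth (0, 0) F i)).
  apply/rowP => j; rewrite !mxE -[in LHS](enum_valK j) -/(c _) -pc.
  transitivity (\sum_(f <- F) phi f * w f (enum_val j)); last first.
    by rewrite (big_nth (0, 0)) big_mkord; apply: eq_bigr => k _; rewrite !mxE.
  set y := enum_val j.
  transitivity (\sum_(f <- undup ([seq rep (edge_rsq (eps y)) | y <- enum Y] ++
          [seq rep (edge_lsq (eps y)) | y <- enum Y])) phi f * w f y); last first.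
    rewrite [RHS]big_filter [RHS]big_mkcond; apply: eq_bigr => f _.
    case: ifP => // /negbT /existsPn /(_ y); rewrite negbK => /eqP ->.
    by rewrite mulr0.
  under eq_bigr do rewrite /w mulrDr ![rep _ == _]eq_sym ![phi _ * _]mulrC.
  rewrite big_split /= !sum_seq_pick ?undup_uniq //.
  - by rewrite /jump (repP (edge_rsq _)) // (repP (edge_lsq _)).
  - by rewrite mem_undup mem_cat; apply/orP; right; apply/mapP; exists y; rewrite ?mem_enum.
  - by rewrite mem_undup mem_cat; apply/orP; left; apply/mapP; exists y; rewrite ?mem_enum.
(* The cycle space has dimension at least [#|Y| - #|V|] and at most [m], where
   [3 * m <= 2 * #|Y|]. *)
have := mxrankS kerW; rewrite mxrank_ker.
have := rank_leq_col B; have := rank_leq_row W; lia.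
Qed.

End PlanarBound.

(** * Counting edges between components *)

Lemma card_pair_sum (I J : finType) (P : I -> {set J}) :
  (#|[set p : I * J | p.2 \in P p.1]%SET| = \sum_i #|P i|)%N.
Proof.
under eq_bigr do rewrite -sum1_card.
rewrite pair_big_dep -sum1_card; apply: eq_bigl => p.
by rewrite inE.
Qed.

(* A connected graph on U has at least |pi(U)| - 1 edges between distinct
   fibres of pi: grow a union of fibres one fibre at a time. *)
Lemma connected_quotient_edges (V Q : finType) (U : {set V}) (pi : V -> Q)
    (e : rel V) :
  (forall Z : {set V}, Z \subset U -> Z != finset.set0 -> Z != U ->
     exists u u', [/\ u \in Z, u' \in U, u' \notin Z & e u u' || e u' u]) ->
  (#|[set pi u | u in U]%SET| <=
   #|[set p : V * V | [&& p.1 \in U, p.2 \in U, e p.1 p.2 & pi p.1 != pi p.2]]%SET| + 1)%N.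
Proof.
move=> cut; set I := [set pi u | u in U]%SET; set P := finset _.
have grow m : (m < #|I|)%N -> exists R : {set Q}, [/\ R \subset I, #|R| = m.+1 &
    (m <= #|[set p in P | (pi p.1 \in R) && (pi p.2 \in R)]%SET|)%N].
  elim: m => [|m IH] mI.
    case/card_gt0P: mI => q qI; exists [set q]%SET.
    by rewrite finset.sub1set cards1.
  have [R [RI Rm Rc]] := IH (ltnW mI).
  pose Z := [set u in U | pi u \in R]%SET.
  have ZU : Z \subset U by apply/fintype.subsetP => u; rewrite inE => /andP[].
  have Z0 : Z != finset.set0.
    have /card_gt0P[q qR] : (0 < #|R|)%N by rewrite Rm.
    have /imsetP[u uU qu] := fintype.subsetP RI _ qR.
    by apply/set0Pn; exists u; rewrite inE uU -qu.
  have ZnU : Z != U.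
    apply/eqP => ZE; have := mI; rewrite -Rm ltnNge subset_leq_card //.
    apply/fintype.subsetP => q /imsetP[u uU ->].
    by move: uU; rewrite -ZE inE => /andP[].
  have [u [u' [uZ u'U u'Z ee]]] := cut Z ZU Z0 ZnU.
  have [uU uR] : u \in U /\ pi u \in R by move: uZ; rewrite inE => /andP.
  have u'R : pi u' \notin R by move: u'Z; rewrite inE u'U.
  have neq : pi u != pi u' by apply/eqP => uu; rewrite -uu uR in u'R.
  have neq' : pi u' != pi u by rewrite eq_sym.
  exists (pi u' |: R)%SET; split.
  - by rewrite finset.subUset finset.sub1set RI andbT; apply/imsetP; exists u'.
  - by rewrite cardsU1 u'R Rm.
  (* The edge leaving [Z] may point either way. It was not counted before, as one of its ends lies
     outside the fibres over [R]. *)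
  have [p [p1 p2]] : exists p, p \in P /\ (pi p.1, pi p.2) \in
      [:: (pi u, pi u'); (pi u', pi u)].
    by case/orP: ee => ee; [exists (u, u')|exists (u', u)];
      rewrite !inE /= uU u'U ee ?neq ?neq' !eqxx ?orbT.
  apply: (@leq_trans #|p |: [set p in P | (pi p.1 \in R) && (pi p.2 \in R)]%SET|%SET).
    rewrite cardsU1 !inE; move: p2; rewrite !inE => /orP[] /eqP[-> ->];
    by rewrite (negbTE u'R) ?andbF /= ?andbF add1n ltnS.
  apply/subset_leq_card/fintype.subsetP => x; rewrite !inE => /orP[/eqP->|].
    move: p1; rewrite inE => ->; move: p2; rewrite !inE.
    by case/orP => /eqP[-> ->]; rewrite uR eqxx ?orbT.
  by case/andP => -> /andP[-> ->]; rewrite !orbT.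
case E: #|I| => [//|m].
have [|R [_ _ h]] := grow m; first by rewrite E.
rewrite addn1 ltnS; apply: leq_trans h _; apply/subset_leq_card/fintype.subsetP => p.
by rewrite inE => /andP[].
Qed.

(* [sg v] is the (k+1)-set supporting the component [v], [tau w] the k-set
   supporting [w], and [inc v t] the component over [t] containing [v]. For
   each [s] edges between two components over [s] are kept only inside the
   components over the single k-subset [star s]; this makes the edge sets
   counted for distinct [w] disjoint. *)
Lemma component_edge_count (V W : finType) (n k : nat)
    (sg : V -> {set 'I_n}) (tau : W -> {set 'I_n})
    (inc : V -> {set 'I_n} -> W) (e : rel V)
    (mem := fun w => [set v | (tau w \subset sg v) && (inc v (tau w) == w)]%SET) :
  (forall v, #|sg v| = k.+1) -> (forall w, #|tau w| = k) ->
  (forall v (t : {set 'I_n}), t \subset sg v -> #|t| = k -> tau (inc v t) = t) ->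
  (forall w (Z : {set V}), Z \subset mem w -> Z != finset.set0 -> Z != mem w ->
     exists u u', [/\ u \in Z, u' \in mem w, u' \notin Z & e u u' || e u' u]) ->
  (k * #|[set sg v | v in V]%SET| + #|V| <=
   #|[set p : V * V | (p.1 != p.2) && e p.1 p.2]%SET| + #|W|)%N.
Proof.
move=> sgk tauk incP cut.
(* The default is reached only for empty [s], never for a value of [sg]. *)
pose star (s : {set 'I_n}) : {set 'I_n} := if [pick x in s] is Some x then (s :\ x)%SET else s.
have starP v : star (sg v) \subset sg v /\ #|star (sg v)| = k.
  rewrite /star; case: pickP => [x xs|s0].
    by split; [exact: finset.subD1set|have := cardsD1 x (sg v); rewrite xs sgk => -[]].
  by have := sgk v; rewrite eq_card0.
(* Components over the same [s] stay distinct in [w] only if [tau w] is [star s]; otherwise they are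
   merged, and edges between them are not counted. *)
pose pi w v : (V + {set 'I_n})%type := if tau w == star (sg v) then inl v else inr (sg v).
pose P w := [set p : V * V |
  [&& p.1 \in mem w, p.2 \in mem w, e p.1 p.2 & pi w p.1 != pi w p.2]]%SET.
pose Q w := [set pi w v | v in mem w]%SET.
have QP : (\sum_w #|Q w| <= \sum_w #|P w| + #|W|)%N.
  rewrite -[X in (_ + X)%N]sum1_card -big_split /=; apply: leq_sum => w _.
  exact: connected_quotient_edges (cut w).
apply: leq_trans (_ : (\sum_w #|P w| + #|W| <= _)%N); last first.
  rewrite leq_add2r -card_pair_sum; set D := finset _.
  (* A counted edge determines [w]: [tau w] is [star (sg u)] if both ends lie over one set, and
     [sg u :&: sg v] otherwise; [inc] then recovers [w]. *)
  have inj : {in D &, injective (@snd W (V * V))}.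
    move=> [w [u v]] [w' [u' v']] /=; rewrite !inE /=.
    case/and4P=> /andP[wu /eqP iu] /andP[wv _] _ wuv.
    case/and4P=> /andP[wu' /eqP iu'] /andP[wv' _] _ wuv' [uE vE].
    subst u' v'; congr (_, _); rewrite -iu -iu'; congr (inc _ _).
    have [uv|uv] := eqVneq (sg u) (sg v).
      move: wuv wuv'; rewrite /pi -uv; case: (tau w =P _) => [->|_]; last by rewrite eqxx.
      by case: (tau w' =P _) => [->|_]; last by rewrite eqxx.
    have lt : (#|(sg u :&: sg v)%SET| <= k)%N.
      rewrite -ltnS -(sgk u); apply: proper_card; rewrite finset.properEneq finset.subsetIl andbT.
      apply/eqP => E; case/eqP: uv; apply/eqP; rewrite eqEcard !sgk leqnn andbT -E.
      exact: finset.subsetIr.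
    have tE x : tau x \subset sg u -> tau x \subset sg v -> tau x = (sg u :&: sg v)%SET.
      by move=> h1 h2; apply/eqP; rewrite eqEcard finset.subsetI h1 h2 tauk.
    by rewrite (tE w) // (tE w').
  rewrite -(card_in_imset inj); apply/subset_leq_card/fintype.subsetP.
  move=> _ /imsetP[[w p] + ->]; rewrite !inE /= => /and4P[_ _ -> pp].
  by rewrite andbT; apply: contra pp => /eqP ->.
apply: leq_trans QP; rewrite -card_pair_sum; set D := finset _.
pose S := [set p : {set 'I_n} * 'I_n | p.2 \in
  (if p.1 \in [set sg v | v in V]%SET then star p.1 else finset.set0)]%SET.
have cardS : #|S| = (k * #|[set sg v | v in V]%SET|)%N.
  rewrite (card_pair_sum _ _ (fun s => if s \in [set sg v | v in V]%SET then star s else finset.set0)).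
  rewrite (bigID (fun s => s \in [set sg v | v in V]%SET)) /= [X in (_ + X)%N]big1; last first.
    by move=> s /negbTE ->; rewrite cards0.
  rewrite addn0 mulnC -sum_nat_const; apply: eq_bigr => s ss; rewrite ss.
  by case/imsetP: ss => v _ ->; case: (starP v).
pose rep (s : {set 'I_n}) (v0 : V) := odflt v0 [pick v | sg v == s].
have [V0|/card_gt0P[v0 _]] := posnP #|V|.
  have -> : [set sg v | v in V]%SET = finset.set0.
    by apply/setP => s; rewrite inE; apply/negP => /imsetP[v]; move: (card0_eq V0 v); rewrite inE.
  by rewrite V0 cards0 muln0.
have repP v : sg (rep (sg v) v0) = sg v.
  by rewrite /rep; case: pickP => [x /eqP//|/(_ v)]; rewrite eqxx.
(* Each [v] gives a fibre of its own over [star (sg v)]. For [x] in [star s] the set [s :\ x] is a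
   k-subset of [s] other than [star s], where [s] gives one merged fibre; this yields k more fibres
   for each [s]. *)
pose f (x : V + ({set 'I_n} * 'I_n)) : W * (V + {set 'I_n}) := match x with
  | inl v => (inc v (star (sg v)), inl v)
  | inr (s, x) => (inc (rep s v0) (s :\ x)%SET, inr s) end.
pose A := [set x : V + ({set 'I_n} * 'I_n) | if x is inr p then p \in S else true]%SET.
have SE s x : (s, x) \in S -> exists v, [/\ s = sg v, x \in star (sg v) & x \in sg v].
  rewrite inE /=; case: ifP => [/imsetP[v _ ->] xs|_]; last by rewrite inE.
  by exists v; split=> //; apply: (fintype.subsetP (starP v).1).
have delP v x : x \in sg v -> (sg v :\ x)%SET \subset sg v /\ #|(sg v :\ x)%SET| = k.
  by move=> xs; split; [exact: finset.subD1set|have := cardsD1 x (sg v); rewrite xs sgk => -[]].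
have AS p : inr p \in A -> p \in S by rewrite inE.
have tauE v x : x \in sg v -> tau (inc (rep (sg v) v0) (sg v :\ x)%SET) = (sg v :\ x)%SET.
  by move=> /delP[h1 h2]; rewrite incP ?repP.
have injf : {in A &, injective f}.
  move=> [v|[s x]] [v'|[s' x']]; try discriminate; first by move=> _ _ [_ ->].
  move=> /AS sx /AS sx' /= [iE ss]; subst s'.
  have [v [sv _ xs]] := SE _ _ sx; have [v' [sv' _ xs']] := SE _ _ sx'.
  subst s; rewrite -sv' in xs'.
  have := congr1 tau iE; rewrite !tauE // => dd.
  congr (inr (_, _)); apply/eqP; rewrite eq_sym; apply/negP => /negP xx.
  by have := in_setD1 x' (sg v) x; rewrite dd !inE eqxx xx xs'.
have cardA : #|A| = (#|S| + #|V|)%N.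
  rewrite -[LHS]sum1_card big_sumType /= addnC; congr addn;
  by rewrite -sum1_card; apply: eq_bigl => x; rewrite inE.
rewrite -cardS -cardA -(card_in_imset injf); apply/subset_leq_card/fintype.subsetP.
move=> _ /imsetP[[v|[s x]] xA ->]; rewrite inE /=.
  apply/imsetP; exists v; rewrite /pi ?inE (incP v) ?eqxx ?(starP v).1 ?(starP v).2 //.
have [v [sv xstar xs]] := SE _ _ (AS _ xA); subst s.
apply/imsetP; exists (rep (sg v) v0); rewrite /pi ?inE tauE // repP.
  by rewrite eqxx (delP v x xs).1.
by case: eqP => // E; move: xstar; rewrite -E !inE eqxx.
Qed.

(** * Spreading labels to form a minor of the grid *)

Lemma count_sub_lt (T : eqType) (a1 a2 : pred T) (s : seq T) (x : T) :
  subpred a1 a2 -> x \in s -> a2 x -> ~~ a1 x -> (count a1 s < count a2 s)%N.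
Proof.
move=> a12 + a2x a1x; elim: s => //= y s IH; rewrite inE => /orP[/eqP <-|/IH h].
  by rewrite a2x (negbTE a1x) add0n add1n ltnS sub_count.
have h' : (a1 y <= a2 y)%N by case E: (a1 y) => //; rewrite (a12 _ E).
by lia.
Qed.

(** While [T] has an unlabelled point, a walk in [T] from a labelled one steps onto an unlabelled
    point, which takes the label of its predecessor. Classes stay connected, no new label appears,
    and the number of unlabelled points drops. *)
Lemma extend_labels (V : eqType) (T dom : seq (int * int)) (t0 : int * int)
    (l : int * int -> option V) :
  (forall p, l p != None -> p \in dom) ->
  (forall v p q, l p = Some v -> l q = Some v ->
     grid_conn (fun z => l z = Some v) p q) ->
  (forall z, z \in T -> grid_conn (fun y => y \in T) t0 z) ->
  (exists2 p, p \in T & l p != None) ->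
  exists (l' : int * int -> option V),
    [/\ forall p, l' p != None -> p \in dom ++ T,
        forall v p q, l' p = Some v -> l' q = Some v ->
          grid_conn (fun z => l' z = Some v) p q,
        forall p, l p != None -> l' p = l p,
        forall p, l' p != None -> l p != None \/ p \in T &
        forall p, p \in T -> exists2 q, q \in T & l q != None /\ l' p = l q].
Proof.
move=> + + Tc [p0 p0T lp0].
have [N] := ubnP (count (fun p => l p == None) T).
elim: N dom l lp0 => // N IH dom l lp0 lN ldom lconn.
have [all_l|] := boolP (all (fun p => l p != None) T).
  exists l; split=> //; last by move=> p pT; exists p; rewrite ?(allP all_l).
    by move=> p /ldom; rewrite mem_cat => ->.
  by move=> p ->; left.
rewrite -has_predC => /hasP[q qT /= /negPn /eqP lq].
have pq := grid_conn_trans _ _ _ _ (grid_conn_sym _ _ _ (Tc _ p0T)) (Tc _ qT).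
have [|x [y [xT yT xy [lx /negP/negPn/eqP ly]]]] :=
  grid_conn_cut _ (fun z => l z != None) _ _ pq lp0; first by rewrite lq.
pose l1 z := if z == y then l x else l z.
have l1E z : l z != None -> l1 z = l z.
  by rewrite /l1; case: (z =P y) => // ->; rewrite ly.
have l1T z : l1 z != None -> l z != None \/ z = y.
  by rewrite /l1; case: (z =P y) => [->|_ ->]; [right|left].
have conn1 v p : l1 p = Some v -> exists2 r, l r = Some v &
    grid_conn (fun z => l1 z = Some v) r p.
  move=> l1p; case: (p =P y) => [py|ny]; last first.
    by exists p; [move: l1p; rewrite /l1; case: (p =P y)|exact: grid_conn_refl].
  have lxv : l x = Some v by move: l1p; rewrite /l1 py eqxx.
  exists x => //; apply: (@grid_conn_step _ _ x) => //; last by rewrite py.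
  by apply: grid_conn_refl; rewrite l1E.
have lconn1 v p q' : l1 p = Some v -> l1 q' = Some v ->
    grid_conn (fun z => l1 z = Some v) p q'.
  move=> /conn1[r rv rp] /conn1[s sv sq].
  apply: grid_conn_trans (grid_conn_sym _ _ _ rp) _.
  apply: grid_conn_trans _ sq; apply: grid_conn_sub (lconn _ _ _ rv sv) => z zv.
  by rewrite l1E // zv.
have [||p|//|l' [ldom' lconn' l'E l'T l'C]] := IH (y :: dom) l1.
- by rewrite l1E.
- rewrite -ltnS; apply: leq_trans lN; rewrite ltnS; apply: (@count_sub_lt _ _ _ _ y) => //=.
  + by move=> z /=; apply: contraTT => lz; rewrite l1E.
  + by rewrite ly.
  + by rewrite /l1 eqxx.
- by case/l1T => [/ldom|->]; rewrite inE ?eqxx // orbC => ->.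
exists l'; split=> //.
- move=> p /ldom'; rewrite mem_cat inE -orbA => /orP[/eqP->|]; last by rewrite mem_cat.
  by rewrite mem_cat yT orbT.
- by move=> p lp; rewrite l'E l1E.
- move=> p /l'T[/l1T[]|]; [by left|by move=> ->; right|by right].
- move=> p /l'C[r rT [lr ->]]; case: (r =P y) => [ry|ny].
    by exists x => //; rewrite /l1 ry eqxx.
  by exists r => //; move: lr; rewrite /l1; case: (r =P y).
Qed.

(** The sets [T w] are treated one after another. They overlap only in points labelled from the
    start, so no extension disturbs another. *)
Lemma extend_labels_family (V : eqType) (W : finType)
    (T : W -> seq (int * int)) (t0 : W -> int * int) (dom : seq (int * int))
    (l : int * int -> option V) :
  (forall p, l p != None -> p \in dom) ->
  (forall v p q, l p = Some v -> l q = Some v ->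
     grid_conn (fun z => l z = Some v) p q) ->
  (forall w z, z \in T w -> grid_conn (fun y => y \in T w) (t0 w) z) ->
  (forall w w' z, w != w' -> z \in T w -> z \in T w' -> l z != None) ->
  exists (dom' : seq (int * int)) (l' : int * int -> option V),
    [/\ forall p, l' p != None -> p \in dom',
        forall v p q, l' p = Some v -> l' q = Some v ->
          grid_conn (fun z => l' z = Some v) p q,
        forall p, l p != None -> l' p = l p &
        forall w p q, p \in T w -> l p != None -> q \in T w ->
          exists2 r, r \in T w & l r != None /\ l' q = l r].
Proof.
move=> ldom lconn Tc TT.
have main (ws : seq W) : uniq ws -> exists (dom' : seq (int * int)) (l' : int * int -> option V),
    [/\ forall p, l' p != None -> p \in dom',
        forall v p q, l' p = Some v -> l' q = Some v ->
          grid_conn (fun z => l' z = Some v) p q,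
        forall p, l p != None -> l' p = l p,
        forall p, l' p != None -> l p != None \/ exists2 w, w \in ws & p \in T w &
        forall w p q, w \in ws -> p \in T w -> l p != None -> q \in T w ->
          exists2 r, r \in T w & l r != None /\ l' q = l r].
  elim: ws => [_|w ws IH /= /andP[wws uws]].
    by exists dom, l; split=> // p lp0; left.
  have [dom1 [l1 [d1 c1 e1 n1 t1]]] := IH uws.
  have T1 p : p \in T w -> l1 p != None -> l p != None.
    move=> pT /n1[//|[w' w'ws pT']]; apply: (TT w w') => //.
    by apply: contraNneq wws => ->.
  (* A set [T w] without any labelled point has nothing to spread and is left alone. *)
  have [[p0 p0T lp0]|no] := EM (exists2 p, p \in T w & l p != None); last first.
    exists dom1, l1; split=> //.
      by move=> p /n1[|[w' w'ws ?]]; [left|right; exists w'; rewrite // inE w'ws orbT].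
    move=> w' p q; rewrite inE => /orP[/eqP->|]; last exact: t1.
    by move=> pT lp0; case: no; exists p.
  have [|l2 [d2 c2 e2 n2 t2]] := extend_labels _ (T w) dom1 (t0 w) l1 d1 c1 (Tc w).
    by exists p0 => //; rewrite e1.
  have e12 p : l p != None -> l2 p = l p by move=> lp1; rewrite e2 e1.
  exists (dom1 ++ T w), l2; split=> //.
    move=> p /n2[/n1[|[w' w'ws ?]]|pT]; first by left.
      by right; exists w'; rewrite // inE w'ws orbT.
    by right; exists w; rewrite // mem_head.
  move=> w' p q; rewrite inE => /orP[/eqP->|w'ws] pT lp1 qT.
    have [r rT [lr ->]] := t2 _ qT; exists r => //.
    by have lr' := T1 _ rT lr; rewrite e1.
  have [r rT [lr E]] := t1 _ _ _ w'ws pT lp1 qT.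
  by exists r => //; rewrite e2 E.
have [dom' [l' [d c e _ t]]] := main (enum W) (enum_uniq W).
by exists dom', l'; split=> // w p q; apply: t; rewrite mem_enum.
Qed.

(** The sets [S v] give the initial labels, spread over the sets [T w]. Two vertices are adjacent
    when their label classes touch, which gives a simple minor of the grid; each [T w], being
    connected, makes [mem w] connected in it. *)
Lemma plane_incidence_graph (V W : finType) (mem : W -> {set V})
    (S : V -> seq (int * int)) (s0 : V -> int * int)
    (T : W -> seq (int * int)) (t0 : W -> int * int) :
  (forall v z, z \in S v -> grid_conn (fun y => y \in S v) (s0 v) z) ->
  (forall v v' z, z \in S v -> z \in S v' -> v = v') ->
  (forall w z, z \in T w -> grid_conn (fun y => y \in T w) (t0 w) z) ->
  (forall w w' z, w != w' -> z \in T w -> z \in T w' -> exists v, z \in S v) ->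
  (forall w v z, z \in T w -> z \in S v -> v \in mem w) ->
  (forall w v, v \in mem w -> exists2 z, z \in T w & z \in S v) ->
  exists e : rel V,
    (#|[set p : V * V | (p.1 != p.2) && e p.1 p.2]%SET| <= 3 * #|V|)%N /\
    forall w (Z : {set V}), Z \subset mem w -> Z != finset.set0 -> Z != mem w ->
      exists u u', [/\ u \in Z, u' \in mem w, u' \notin Z & e u u' || e u' u].
Proof.
move=> Sc Sd Tc TT TS ST.
pose l z := [pick v | z \in S v].
have lP z v : l z = Some v <-> z \in S v.
  rewrite /l; case: pickP => [x xS|no]; last by split=> //; rewrite no.
  by split=> [[<-]//|zv]; rewrite (Sd _ _ _ xS zv).
have lN z : l z != None -> exists v, z \in S v.
  by case E: (l z) => [v|] // _; exists v; apply/lP.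
have [||||dom' [l' [ldom lconn lE lT]]] :=
    extend_labels_family V W T t0 (flatten [seq S v | v <- enum V]) l.
- move=> z /lN[v zv]; apply/flattenP; exists (S v) => //; apply: map_f.
  by rewrite mem_enum.
- move=> v p q /lP pv /lP qv.
  apply: grid_conn_sub (grid_conn_trans _ _ _ _ (grid_conn_sym _ _ _ (Sc _ _ pv)) (Sc _ _ qv)).
  by move=> z /lP.
- exact: Tc.
- by move=> w w' z ww zw zw'; have [v /lP ->] := TT _ _ _ ww zw zw'.
pose M u v := exists e, l' e.1 = Some u /\ l' (edge_tgt e) = Some v.
(* Ordering by rank keeps one orientation of each adjacent pair, so no two edges are parallel. *)
pose e u v := (enum_rank u < enum_rank v)%N && `[< M u v \/ M v u >].
exists e; split.
  pose Y := {p : V * V | (p.1 != p.2) && e p.1 p.2}.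
  have -> : #|[set p : V * V | (p.1 != p.2) && e p.1 p.2]%SET| = #|{: Y}|.
    by rewrite card_sig; apply: eq_card => p; rewrite !inE.
  have /choice[f Hf] : forall y : Y, exists f : (int * int * bool) * (V * V),
      [/\ l' f.1.1 = Some f.2.1, l' (edge_tgt f.1) = Some f.2.2 &
          f.2 = val y \/ (f.2.2, f.2.1) = val y].
    move=> [[u v] /= /andP[_ /andP[_ /asboolP[]]]] [x [xu xv]].
      by exists (x, (u, v)); split=> //; left.
    by exists (x, (v, u)); split=> //; right.
  have Ylt (y : Y) : (val y).1 != (val y).2 /\ (enum_rank (val y).1 < enum_rank (val y).2)%N.
    by case: y => p /= /andP[-> /andP[-> _]].
  apply: (@grid_minor_edge_bound V Y l' dom' (fun y => (f y).1)
    (fun y => (f y).2.1) (fun y => (f y).2.2)) => //.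
  - by move=> y; case: (Hf y).
  - by move=> y; case: (Hf y).
  - move=> y; have := (Ylt y).1; case: (Hf y) => _ _ [<-//|<-] /=.
    by rewrite eq_sym.
  - move=> y y' h; apply: val_inj; have := (Ylt y).2; have := (Ylt y').2.
    case: (Hf y) (Hf y') => _ _ + [_ _] {Hf}.
    case: (f y) h => [x [a b]]; case: (f y') => [x' [a' b']] /=.
    by case=> -[-> ->] [<-|<-] [<-|<-] //=; lia.
move=> w Z Zm Z0 Zw.
have /set0Pn[u uZ] := Z0.
have [u' u'm u'Z] : exists2 u', u' \in mem w & u' \notin Z.
  have /fintype.subsetPn[u' ? ?] : ~~ (mem w \subset Z).
    by apply: contra Zw => h; rewrite finset.eqEsubset Zm h.
  by exists u'.
have [p pT /lP pS] := ST _ _ (fintype.subsetP Zm _ uZ).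
have [p' p'T /lP p'S] := ST _ _ u'm.
have pp' := grid_conn_trans _ _ _ _ (grid_conn_sym _ _ _ (Tc _ _ pT)) (Tc _ _ p'T).
(* A walk in [T w] from a point labelled [u] to one labelled [u'] leaves the labels in [Z] at the
   step from [a] to [b]. The label of [b] is an initial label of some point of [T w], hence belongs
   to [mem w]. *)
have [||a [b [aT bT ab [[v vZ lv] nb]]]] :=
    grid_conn_cut _ (fun z => exists2 v, v \in Z & l' z = Some v) _ _ pp'.
- by exists u; rewrite // lE ?pS.
- by case=> v vZ; rewrite lE ?p'S // => -[vu]; rewrite vu vZ in u'Z.
have lp0 : l p != None by rewrite pS.
have [r rT [lr l'b]] := lT _ _ _ pT lp0 bT.
have [v' v'r] := lN _ lr.
have lr' : l r = Some v' by apply/lP.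
exists v, v'; split=> //.
- exact: TS rT v'r.
- by apply/negP => v'Z; case: nb; exists v' => //; rewrite l'b.
have vv' : v != v' by apply/eqP => E; case: nb; exists v' => //; [rewrite -E|rewrite l'b].
have MM : M v v' \/ M v' v.
  case: ab => x [[x1 x2]|[x1 x2]]; [left|right]; exists x; by rewrite x1 x2 lv l'b lr'.
rewrite /e; have -> : `[< M v v' \/ M v' v >] by apply/asboolP.
have -> : `[< M v' v \/ M v v' >] by apply/asboolP; rewrite or_comm.
rewrite !andbT; case: ltngtP => // E; case/eqP: vv'.
by apply: enum_rank_inj; apply/val_inj.
Qed.

(** * Chains of squares and their discretisation *)

Set Implicit Arguments.
Unset Strict Implicit.

Definition grid_embed (R : realType) (h : R) (z : int * int) : R * R :=
  (z.1%:~R * h, z.2%:~R * h).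

Definition grid_floor (R : realType) (h : R) (x : R * R) : int * int :=
  (Num.floor (x.1 / h), Num.floor (x.2 / h)).

Definition square (R : realType) (c : R * R) (s : R) : set (R * R) :=
  [set x | `|x.1 - c.1| < s /\ `|x.2 - c.2| < s].

Definition closed_square (R : realType) (c : R * R) (s : R) : set (R * R) :=
  [set x | `|x.1 - c.1| <= s /\ `|x.2 - c.2| <= s].

Lemma square_nbhs (R : realType) (c x : R * R) (s : R) :
  square c s x -> nbhs x (square c s).
Proof.
case=> x1 x2; apply/nbhs_ballP.
exists (Num.min (s - `|x.1 - c.1|) (s - `|x.2 - c.2|)).
  by rewrite /= lt_min !subr_gt0 x1 x2.
move=> y [] /=; rewrite /ball /= !lt_min => /andP[y1 _] /andP[_ y2].
split; [apply: le_lt_trans (ler_distD x.1 _ _) _|apply: le_lt_trans (ler_distD x.2 _ _) _].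
  by rewrite (distrC y.1); lra.
by rewrite (distrC y.2); lra.
Qed.

Lemma compact_closed_square (R : realType) (c : R * R) (s : R) :
  compact (closed_square c s).
Proof.
have -> : closed_square c s =
    `[c.1 - s, c.1 + s]%classic `*` `[c.2 - s, c.2 + s]%classic.
  by apply/seteqP; split=> x; rewrite /closed_square /= !in_itv /= !ler_distl.
by apply: compact_setX; exact: segment_compact.
Qed.

Lemma open_square (R : realType) (A : set (R * R)) (u : R * R) :
  open A -> A u -> exists2 s : R, 0 < s & square u s `<=` A.
Proof.
rewrite openE => oA /oA /nbhs_ballP[e /= e0 uA]; exists e => //.
by move=> x [x1 x2]; apply: uA; split; rewrite /ball /= distrC.
Qed.

(** Halfway between [s] and the largest coordinate distance from [c] there is room for a closed,
    hence compact, square. *)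
Lemma square_shrink (R : realType) (c u v : R * R) (s : R) :
  square c s u -> square c s v -> exists s',
    [/\ square c s' u, square c s' v & closed_square c s' `<=` square c s].
Proof.
move=> [u1 u2] [v1 v2].
pose m := Num.max (Num.max `|u.1 - c.1| `|u.2 - c.2|)
                  (Num.max `|v.1 - c.1| `|v.2 - c.2|).
have [ms] : m < s by rewrite !gt_max u1 u2 v1 v2.
have : m <= m by [].
rewrite {1}/m !ge_max => /andP[/andP[mu1 mu2] /andP[mv1 mv2]].
exists ((m + s) / 2); split.
- by split; [apply: le_lt_trans mu1 _|apply: le_lt_trans mu2 _]; lra.
- by split; [apply: le_lt_trans mv1 _|apply: le_lt_trans mv2 _]; lra.
- by move=> x [x1 x2]; split; [apply: le_lt_trans x1 _|apply: le_lt_trans x2 _]; lra.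
Qed.

Lemma grid_floor_near (R : realType) (u : R * R) (U : set (R * R)) :
  nbhs u U -> \forall h \near 0^'+, U (grid_embed h (grid_floor h u)).
Proof.
move=> /nbhs_ballP[e /= e0 uU]; near=> h; apply: uU.
have h0 : 0 < h by near: h; exact: nbhs_right_gt.
have he : h < e by near: h; exact: nbhs_right_lt.
have fl (a : R) : `|a - (Num.floor (a / h))%:~R * h| < e.
  have /andP[f1 f2] := floor_itv (a / h).
  move: f1 f2; rewrite ler_pdivlMr // ltr_pdivrMr // intrD mulrDl mul1r => f1 f2.
  by rewrite ger0_norm; lra.
by split; exact: fl.
Unshelve. all: by end_near. Qed.

Lemma grid_line (X : int * int -> Prop) (b : bool) (p : int * int) (n : nat)
    (shift := fun m : nat => if b then (p.1, p.2 + m%:Z) else (p.1 + m%:Z, p.2)) :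
  (forall m : nat, (m <= n)%N -> X (shift m)) -> grid_conn X (shift 0%N) (shift n).
Proof.
elim: n => [|n IH] Xs; first by apply: grid_conn_refl; exact: Xs.
apply: (@grid_conn_step _ _ (shift n)); last exact: Xs.
  by apply: IH => m mn; apply: Xs; exact: leqW.
exists (shift n, b); left; split=> //; rewrite /edge_tgt /shift /=.
by case: (b) => /=; congr (_, _); lia.
Qed.

Lemma square_grid_conn (R : realType) (c : R * R) (s h : R) (z z' : int * int) :
  0 < h -> square c s (grid_embed h z) -> square c s (grid_embed h z') ->
  grid_conn (fun y => closed_square c s (grid_embed h y)) z z'.
Proof.
move=> h0 [z1 z2] [z1' z2'].
have conv (i i' : int) (m : nat) (a : R) : i + m%:Z <= i' ->
    `|i%:~R * h - a| < s -> `|i'%:~R * h - a| < s -> `|(i + m%:Z)%:~R * h - a| <= s.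
  move=> mi; rewrite !ltr_distl ler_distl => /andP[a1 a2] /andP[a3 a4].
  have m0 : i%:~R * h <= (i + m%:Z)%:~R * h by rewrite ler_pM2r // ler_int; lia.
  have m1 : (i + m%:Z)%:~R * h <= i'%:~R * h by rewrite ler_pM2r // ler_int.
  by apply/andP; split; lra.
have horiz (i i' j : int) : i <= i' -> square c s (grid_embed h (i, j)) ->
    square c s (grid_embed h (i', j)) ->
    grid_conn (fun y => closed_square c s (grid_embed h y)) (i, j) (i', j).
  move=> ii [/= a1 a2] [/= b1 b2].
  have := @grid_line (fun y => closed_square c s (grid_embed h y)) false (i, j) `|i' - i|%N.
  rewrite /= addr0; have -> : i + `|i' - i|%N%:Z = i' by lia.
  apply=> m mi; split; rewrite /=; last exact: ltW.
  by apply: (conv i i') => //; lia.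
have vert (i j j' : int) : j <= j' -> square c s (grid_embed h (i, j)) ->
    square c s (grid_embed h (i, j')) ->
    grid_conn (fun y => closed_square c s (grid_embed h y)) (i, j) (i, j').
  move=> ii [/= a1 a2] [/= b1 b2].
  have := @grid_line (fun y => closed_square c s (grid_embed h y)) true (i, j) `|j' - j|%N.
  rewrite /= addr0; have -> : j + `|j' - j|%N%:Z = j' by lia.
  apply=> m mi; split; rewrite /=; first exact: ltW.
  by apply: (conv j j') => //; lia.
case: z z1 z2 => i j z1 z2; case: z' z1' z2' => i' j' z1' z2'.
(* An L-shaped walk: its corner takes one coordinate from each end, so it lies in the square. *)
apply: (@grid_conn_trans _ _ (i', j)).
  by case/orP: (le_total i i') => ii; [|apply: grid_conn_sym]; apply: horiz.
by case/orP: (le_total j j') => ii; [|apply: grid_conn_sym]; apply: vert.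
Qed.

Definition square_link (R : realType) (A : set (R * R)) (u v : R * R) : Prop :=
  exists c s, [/\ square c s u, square c s v & square c s `<=` A].

(* In an open set these are the path components, but only the inclusion
   [path_joined_chain] is needed. *)
Inductive square_chain (R : realType) (A : set (R * R)) (u : R * R) :
    R * R -> Prop :=
| square_chain_refl : A u -> square_chain A u u
| square_chain_step v w :
    square_chain A u v -> square_link A v w -> square_chain A u w.

Section SquareChain.
Variable (R : realType).
Implicit Types (A B : set (R * R)) (u v w : R * R).

Lemma square_chain_mem A u v : square_chain A u v -> A v.
Proof. by case=> // w x _ [c [s [_ sx cA]]]; exact: cA. Qed.

Lemma square_chain_trans A u v w :
  square_chain A u v -> square_chain A v w -> square_chain A u w.
Proof. by move=> uv; elim=> // x y _ ux xy; exact: square_chain_step ux xy. Qed.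

Lemma square_link_mem A u v : square_link A u v -> A u /\ A v.
Proof. by case=> c [s [cu cv cA]]; split; exact: cA. Qed.

Lemma square_link_sym A u v : square_link A u v -> square_link A v u.
Proof. by case=> c [s [cu cv cA]]; exists c, s. Qed.

Lemma square_chain_sym A u v : square_chain A u v -> square_chain A v u.
Proof.
elim=> [Au|x y ux xu xy]; first exact: square_chain_refl.
have [_ Ay] := square_link_mem xy.
apply: square_chain_trans xu; apply: square_chain_step (square_link_sym xy).
exact: square_chain_refl.
Qed.

Lemma square_chain_sub A B u v :
  A `<=` B -> square_chain A u v -> square_chain B u v.
Proof.
move=> AB; elim=> [Au|x y _ ux [c [s [cx cy cA]]]].
  by apply/square_chain_refl/AB.
apply: square_chain_step ux _; exists c, s; split=> //.
exact: subset_trans cA AB.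
Qed.

Lemma open_square_link A u : open A -> A u -> square_link A u u.
Proof.
move=> oA /(open_square oA)[s s0 sA]; exists u, s.
by split=> //; rewrite /square /= !subrr normr0.
Qed.

Lemma square_chain_nbhs A u v :
  open A -> square_chain A u v -> nbhs v (square_chain A u).
Proof.
move=> oA uv; have [c [s [cv _ cA]]] := open_square_link oA (square_chain_mem uv).
apply: filterS (square_nbhs cv) => x cx.
by apply: square_chain_step uv _; exists c, s.
Qed.

(** The chain class of [u] and its complement in [A] are both open, so the connected image of the
    path cannot meet both. *)
Lemma path_joined_chain A u v :
  open A -> path_joined R A u v -> square_chain A u v.
Proof.
move=> oA [g [gc g0 g1 gA]].
have gconn : connected (g @` `[0, 1]).
  by apply: connected_continuous_connected gc; exact: segment_connected.
have gu : (g @` `[0, 1]) u by exists 0; rewrite //= in_itv /= lexx ler01.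
have gv : (g @` `[0, 1]) v by exists 1; rewrite //= in_itv /= lexx ler01.
pose C := [set x | square_chain A u x]; pose N := [set x | A x /\ ~ square_chain A u x].
have oC : open C by rewrite openE => x; exact: square_chain_nbhs.
have oN : open N.
  rewrite openE => x [Ax nx].
  apply: filterS (square_chain_nbhs oA (square_chain_refl Ax)) => y xy.
  split; first exact: square_chain_mem xy.
  by move=> uy; apply: nx; apply: square_chain_trans uy _; exact: square_chain_sym.
suff : g @` `[0, 1] `&` C = g @` `[0, 1] by move=> E; move: gv; rewrite -E => -[].
apply: gconn.
- by exists u; split=> //; apply: square_chain_refl; exact: gA.
- by exists C.
- exists (~` N); first exact: open_closedC.
  apply/seteqP; split=> x [gx].
    by move=> Cx; split=> // -[].
  by move=> nN; split=> //; apply: contrapT => nC; apply: nN; split=> //; exact: gA.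
Qed.

(** [K] is the union of slightly shrunk closed squares of the chain. A whole neighbourhood of the
    endpoint is reached, which serves both the induction and later compactness arguments. *)
Lemma square_chain_grid A u v : open A -> square_chain A u v ->
  exists K : set (R * R), [/\ compact K, K `<=` square_chain A u &
    exists U : set (R * R), nbhs v U /\ \forall h \near 0^'+, forall z,
      U (grid_embed h z) ->
      grid_conn (fun y => K (grid_embed h y)) (grid_floor h u) z].
Proof.
move=> oA; elim=> [Au|x y ux [K [cK KA [U [xU Uh]]]] [c [s [cx cy cA]]]].
  have [c [t [cu' _ cA]]] := open_square_link oA Au.
  have [s [cu _ cs]] := square_shrink cu' cu'.
  exists (closed_square c s); split.
  - exact: compact_closed_square.
  - move=> p /cs cp; apply: square_chain_step (square_chain_refl Au) _.
    by exists c, t.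
  - exists (square c s); split; first exact: square_nbhs.
    near=> h; move=> z cz.
    have h0 : 0 < h by near: h; exact: nbhs_right_gt.
    apply: square_grid_conn => //.
    by near: h; apply: grid_floor_near; exact: square_nbhs.
have [s' [cx' cy' cs]] := square_shrink cx cy.
exists (K `|` closed_square c s'); split.
- by apply: compactU => //; exact: compact_closed_square.
- move=> p [/KA//|/cs cp]; apply: square_chain_step ux _.
  by exists c, s.
- exists (square c s'); split; first exact: square_nbhs.
  near=> h; move=> z cz; apply: (@grid_conn_trans _ _ (grid_floor h x)).
    apply: (@grid_conn_sub (fun y => K (grid_embed h y))) => [p Kp|]; first by left.
    have /(_ (grid_floor h x)) : forall z, U (grid_embed h z) ->
      grid_conn (fun y => K (grid_embed h y)) (grid_floor h u) z by near: h.
    by apply; near: h; exact: grid_floor_near.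
  apply: (@grid_conn_sub (fun y => closed_square c s' (grid_embed h y))) => [p Kp|]; first by right.
  have h0 : 0 < h by near: h; exact: nbhs_right_gt.
  apply: square_grid_conn => //.
  by near: h; apply: grid_floor_near; exact: square_nbhs.
Unshelve. all: by end_near. Qed.
End SquareChain.

Lemma square_chain_grid_seq (R : realType) (A : set (R * R)) (u : R * R)
    (vs : seq (R * R)) :
  open A -> (forall v, v \in vs -> square_chain A u v) ->
  exists K : set (R * R), [/\ compact K, K `<=` square_chain A u &
    \forall h \near 0^'+, forall v, v \in vs ->
      grid_conn (fun y => K (grid_embed h y)) (grid_floor h u) (grid_floor h v)].
Proof.
move=> oA; elim: vs => [_|v vs IH uvs].
  exists set0; split; [exact: compact0|by []|by near=> h].
have [w wvs|K [cK KA Kh]] := IH; first by apply: uvs; rewrite inE wvs orbT.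
have [K' [cK' KA' [U [vU Uh]]]] := square_chain_grid oA (uvs v (mem_head _ _)).
exists (K `|` K'); split; [exact: compactU|by move=> x [/KA|/KA']|].
near=> h; move=> w; rewrite inE => /orP[/eqP->|wvs].
  apply: (@grid_conn_sub (fun y => K' (grid_embed h y))) => [y ?|]; first by right.
  have : forall z, U (grid_embed h z) ->
      grid_conn (fun y => K' (grid_embed h y)) (grid_floor h u) z by near: h.
  by apply; near: h; exact: grid_floor_near.
apply: (@grid_conn_sub (fun y => K (grid_embed h y))) => [y ?|]; first by left.
have : forall v, v \in vs ->
  grid_conn (fun y => K (grid_embed h y)) (grid_floor h u) (grid_floor h v) by near: h.
exact.
Unshelve. all: by end_near. Qed.

(** Fix compact sets [K w] carrying the walks to all [a v] in [C w], then one mesh [h] fine enough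
    for the finitely many conditions; the finite grid sets [T w] and [S v] then have the incidences
    of the classes. *)
Lemma plane_components_graph (R : realType) (V W : finType)
    (A : V -> set (R * R)) (B : W -> set (R * R)) (a : V -> R * R) (b : W -> R * R)
    (D := fun v => square_chain (A v) (a v))
    (C := fun w => square_chain (B w) (b w)) :
  (forall v, open (A v)) -> (forall w, open (B w)) -> (forall v, A v (a v)) ->
  (forall v v' x, D v x -> D v' x -> v = v') ->
  (forall w w' x, w != w' -> C w x -> C w' x -> exists v, D v x) ->
  (forall w v x, C w x -> D v x -> C w (a v)) ->
  exists e : rel V,
    (#|[set p : V * V | (p.1 != p.2) && e p.1 p.2]%SET| <= 3 * #|V|)%N /\
    forall w (Z : {set V}), Z \subset [set v | `[< C w (a v) >]]%SET ->
      Z != finset.set0 -> Z != [set v | `[< C w (a v) >]]%SET ->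
      exists u u', [/\ u \in Z, u' \in [set v | `[< C w (a v) >]]%SET,
        u' \notin Z & e u u' || e u' u].
Proof.
move=> oA oB Aa DD CC CD; pose mem w := [set v | `[< C w (a v) >]]%SET.
have memP w v : v \in mem w <-> C w (a v).
  by rewrite inE; split=> [/asboolP|?]; last exact/asboolP.
have /choice[K HK] : forall w, exists K : set (R * R),
    [/\ compact K, K `<=` C w & \forall h \near 0^'+, forall v, v \in mem w ->
    grid_conn (fun y => K (grid_embed h y)) (grid_floor h (b w)) (grid_floor h (a v))].
  move=> w; have [||K [cK KC Kh]] :=
    @square_chain_grid_seq _ (B w) (b w) [seq a v | v <- enum (mem w)].
  - exact: oB.
  - by move=> _ /mapP[v + ->]; rewrite mem_enum => /memP.
  exists K; split=> //; apply: filterS Kh => h Kh v vw; apply: Kh.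
  by apply/mapP; exists v; rewrite ?mem_enum.
(* A grid point of the overlap lies in some [D v], but it must also be joined to the rounding of
   [a v] at mesh [h]. Compactness of the overlap makes one bound on [h] serve all its points. *)
have cover w w' : w != w' -> \forall h \near 0^'+, forall z,
    K w (grid_embed h z) -> K w' (grid_embed h z) ->
    exists v, grid_conn (fun y => D v (grid_embed h y)) (grid_floor h (a v)) z.
  move=> ww; have [cK KC _] := HK w; have [cK' KC' _] := HK w'.
  have cKK : compact (K w `&` K w').
    by apply: compact_closedI => //; apply: compact_closed => //; exact: norm_hausdorff.
  have := (compact_near_coveringP _).1 cKK R (0^'+)
    (fun h x => forall z, grid_embed h z = x ->
       exists v, grid_conn (fun y => D v (grid_embed h y)) (grid_floor h (a v)) z) _.
  move=> near_cover; have {near_cover} : \forall h \near 0^'+, K w `&` K w' `<=`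
      [set x | forall z, grid_embed h z = x ->
       exists v, grid_conn (fun y => D v (grid_embed h y)) (grid_floor h (a v)) z].
    apply: near_cover => x [/KC Cx /KC' Cx'].
    have [v Dx] := CC _ _ _ ww Cx Cx'.
    have [L [_ LD [U [xU Uh]]]] := square_chain_grid (oA v) Dx.
    exists (U, [set h | forall z, U (grid_embed h z) ->
      grid_conn (fun y => L (grid_embed h y)) (grid_floor h (a v)) z]) => //.
    move=> [y h] [/= Uy Lh] z zy; exists v.
    apply: (@grid_conn_sub (fun y => L (grid_embed h y))); first by move=> p /LD.
    by apply: Lh; rewrite zy.
  by apply: filterS => h Kh z Kz K'z; exact: Kh (conj Kz K'z) z erefl.
have nK : \forall h \near (0 : R)^'+, forall w v, v \in mem w ->
    grid_conn (fun y => K w (grid_embed h y)) (grid_floor h (b w)) (grid_floor h (a v)).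
  by apply: filter_forall => w; case: (HK w).
have nKK : \forall h \near (0 : R)^'+, forall p : W * W, p.1 != p.2 -> forall z,
    K p.1 (grid_embed h z) -> K p.2 (grid_embed h z) ->
    exists v, grid_conn (fun y => D v (grid_embed h y)) (grid_floor h (a v)) z.
  apply: filter_forall => -[w w'] /=.
  have [->|ww] := eqVneq w w'; first by near=> h.
  by apply: filterS (cover _ _ ww) => h hc _.
have nD : \forall h \near (0 : R)^'+, forall v, D v (grid_embed h (grid_floor h (a v))).
  apply: filter_forall => v; apply: grid_floor_near.
  by apply: square_chain_nbhs => //; exact: square_chain_refl.
have [h [hK [hKK hD]]] := @filter_ex _ (0 : R)^'+ _ _ (filterI nK (filterI nKK nD)).
have /choice[T HT] : forall w, exists T : seq (int * int),
    [/\ forall v, v \in mem w -> grid_floor h (a v) \in T,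
        forall z, z \in T -> K w (grid_embed h z) &
        forall z, z \in T -> grid_conn (fun y => y \in T) (grid_floor h (b w)) z].
  move=> w; have [[v vw]|no] := EM (exists v, v \in mem w); last first.
    by exists [::]; split=> // v vw; case: no; exists v.
  have [|z|T [bT sT TK Tc]] := @grid_conn_finite (fun y => K w (grid_embed h y))
    (grid_floor h (b w)) [seq grid_floor h (a v) | v <- enum (mem w)].
  - exact: grid_conn_left (hK w v vw).
  - by case/mapP => v' + ->; rewrite mem_enum; exact: hK.
  exists T; split=> // v' v'w; apply: sT; apply/mapP; exists v' => //.
  by rewrite mem_enum.
(* [S v] must absorb every point of the sets [T w] that is grid-connected to the rounding of [a v]
   in [D v], so that overlaps of the [T w] are covered. *)
have /choice[S HS] : forall v, exists S : seq (int * int),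
    [/\ grid_floor h (a v) \in S,
        forall w z, z \in T w ->
          grid_conn (fun y => D v (grid_embed h y)) (grid_floor h (a v)) z -> z \in S,
        forall z, z \in S -> D v (grid_embed h z) &
        forall z, z \in S -> grid_conn (fun y => y \in S) (grid_floor h (a v)) z].
  move=> v; have [|z|S [aS sS SD Sc]] := @grid_conn_finite (fun y => D v (grid_embed h y))
    (grid_floor h (a v)) [seq z <- flatten [seq T w | w <- enum W] |
      `[< grid_conn (fun y => D v (grid_embed h y)) (grid_floor h (a v)) z >]].
  - exact: hD.
  - by rewrite mem_filter => /andP[/asboolP].
  exists S; split=> // w z zT zc; apply: sS; rewrite mem_filter; apply/andP; split.
    exact/asboolP.
  by apply/flattenP; exists (T w) => //; apply: map_f; rewrite mem_enum.
apply: (@plane_incidence_graph V W mem S (fun v => grid_floor h (a v)) T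
  (fun w => grid_floor h (b w))).
- by move=> v; case: (HS v).
- move=> v v' z zS zS'; have [_ _ SD _] := HS v; have [_ _ SD' _] := HS v'.
  exact: DD (SD _ zS) (SD' _ zS').
- by move=> w; case: (HT w).
- move=> w w' z ww zT zT'; have [_ TK _] := HT w; have [_ TK' _] := HT w'.
  have [v vz] := hKK (w, w') ww z (TK _ zT) (TK' _ zT').
  by exists v; have [_ h' _ _] := HS v; exact: h' zT vz.
- move=> w v z zT zS; apply/memP; have [_ TK _] := HT w; have [_ _ SD _] := HS v.
  have [_ KC _] := HK w.
  exact: CD (KC _ (TK _ zT)) (SD _ zS).
- move=> w v vw; exists (grid_floor h (a v)); first by case: (HT w) => h' _ _; exact: h'.
  by case: (HS v).
Unshelve. all: by end_near. Qed.

(** Each chain class receives the number of the path component of a chosen point in it; path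
    components lie inside chain classes, so different classes get different numbers. The spare value
    [b] keeps the ordinal type inhabited. *)
Lemma path_components_index (R : realType) (A : set (R * R)) (b : nat) :
  open A -> (path_components R A #<= `I_b)%card ->
  exists cl : R * R -> 'I_b.+1, (forall u, A u -> (cl u < b)%N) /\
    forall u v, A u -> A v -> cl u = cl v <-> square_chain A u v.
Proof.
move=> oA cb.
have /pcard_leP/unsquash f := cb.
have fb u : A u -> (f (path_component R A u) < b)%N.
  by move=> Au; have := @funS _ _ _ _ f (path_component R A u); apply; exists u.
have fchain u v : A u -> A v -> f (path_component R A u) = f (path_component R A v) ->
    square_chain A u v.
  move=> Au Av E; have /(_ _ _ _ _ E) uv := @inj _ _ _ f.
  apply: path_joined_chain => //.
  have -> : path_joined R A u v = path_component R A u v by [].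
  rewrite uv ?inE; [|by exists u|by exists v].
  exists (fun=> v); split=> //; first by apply: continuous_subspaceT => x; exact: cst_continuous.
  by move=> _ [_ _ <-].
pose rep u := xget (0, 0) [set v | square_chain A u v].
have repP u : A u -> square_chain A u (rep u).
  move=> Au; apply: (@xgetPex _ (0, 0) [set v | square_chain A u v]).
  by exists u; exact: square_chain_refl.
have repA u : A u -> A (rep u) by move=> /repP /square_chain_mem.
have repE u v : square_chain A u v -> rep u = rep v.
  move=> uv; congr xget; apply/seteqP; split=> x /=; apply: square_chain_trans => //.
  exact: square_chain_sym.
exists (fun u => inord (f (path_component R A (rep u)))); split=> [u Au|u v Au Av].
  by rewrite inordK ?fb ?ltnS //; [exact: repA|apply: ltnW; apply/fb/repA].
split=> [|/repE -> //] /(congr1 val) /=.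
rewrite !inordK; try by rewrite ltnS ltnW // fb //; exact: repA.
move=> /(fchain _ _ (repA _ Au) (repA _ Av)) uv.
apply: square_chain_trans (repP _ Au) _; apply: square_chain_trans uv _.
exact/square_chain_sym/repP.
Qed.

(** * Components of the intersections *)

Lemma inter_setU (T : Type) (n : nat) (A : 'I_n -> set T) (s t : {set 'I_n}) x :
  inter A s x -> inter A t x -> inter A (s :|: t)%SET x.
Proof. by move=> sx tx i /=; rewrite inE => /orP[]; [exact: sx|exact: tx]. Qed.

Lemma inter_subset (T : Type) (n : nat) (A : 'I_n -> set T) (s t : {set 'I_n}) :
  s \subset t -> inter A t `<=` inter A s.
Proof. by move=> st x tx i /= si; apply: tx; exact: (fintype.subsetP st). Qed.

(** The nerve is closed under subsets, so a larger set could be cut down to [k.+1] elements. *)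
Lemma fnum0_card_le (T : Type) (n k : nat) (A : 'I_n -> set T) (s : {set 'I_n}) x :
  fnum k A = 0%N -> inter A s x -> (#|s| <= k)%N.
Proof.
move=> f0 sx; rewrite leqNgt; apply/negP => ks.
pose t := [set i in take k.+1 (enum s)]%SET.
have ts : t \subset s.
  by apply/fintype.subsetP => i; rewrite inE => /mem_take; rewrite mem_enum.
have ct : #|t| = k.+1.
  have /card_uniqP := take_uniq k.+1 (enum_uniq s).
  by rewrite size_takel -?cardE // cardsE.
have /card0_eq/(_ t) := f0.
rewrite !inE ct eqxx andbT => /negP; apply; apply/asboolP; exists x.
exact: inter_subset sx.
Qed.

Theorem theorem2p2 (R : realType) (b k n : nat) (A : 'I_n -> set (R * R))
  (hb : (2 <= b)%N) (hk : (2 * b < k)%N)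
  (hdim : fnum k.+1 A = 0%N)
  (hcomp : forall s : {set 'I_n}, #|s| = k \/ #|s| = k.+1 ->
     open (inter A s) /\ (path_components R (inter A s) #<= `I_b)%card) :
  (fnum k A)%:R <= b%:R / (k%:R - 2 * b%:R) * (fnum_ind k.-1 A)%:R :> R.
Proof.
have k0 : (0 < k)%N by lia.
have /choice[cl Hcl] : forall s : {set 'I_n}, exists cl : R * R -> 'I_b.+1,
    #|s| = k \/ #|s| = k.+1 -> (forall u, inter A s u -> (cl u < b)%N) /\
    forall u v, inter A s u -> inter A s v ->
      cl u = cl v <-> square_chain (inter A s) u v.
  move=> s; have [sk|ns] := EM (#|s| = k \/ #|s| = k.+1); last by exists (fun=> ord0).
  have [oA cA] := hcomp s sk.
  by have [cl ?] := path_components_index oA cA; exists cl.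
(* A class is encoded as its index set paired with a number attained on the intersection. *)
pose isc (x : {set 'I_n} * 'I_b.+1) := `[< exists u, inter A x.1 u /\ cl x.1 u = x.2 >].
pose PV (x : {set 'I_n} * 'I_b.+1) := (#|x.1| == k.+1) && isc x.
pose PW (x : {set 'I_n} * 'I_b.+1) := [&& #|x.1| == k, isc x &
  [exists s in nerve A, (x.1 \subset s) && (#|s| == k.+1)]].
pose V : finType := {x | PV x}; pose W : finType := {x | PW x}.
pose sg (v : V) := (val v).1; pose tau (w : W) := (val w).1.
have sgk v : #|sg v| = k.+1 by have /andP[/eqP] := valP v.
have tauk w : #|tau w| = k by have /and3P[/eqP] := valP w.
have /choice[a Ha] : forall v : V, exists u, inter A (sg v) u /\ cl (sg v) u = (val v).2.
  by move=> v; have /andP[_ /asboolP] := valP v.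
have /choice[d Hd] : forall w : W, exists u, inter A (tau w) u /\ cl (tau w) u = (val w).2.
  by move=> w; have /and3P[_ /asboolP] := valP w.
have sgcl v := (Hcl (sg v) (or_intror (sgk v))).
have taucl w := (Hcl (tau w) (or_introl (tauk w))).
have small s x : inter A s x -> (#|s| <= k.+1)%N by exact: fnum0_card_le.
(* The union of [t] and [sg v] lies in the nerve, hence has at most [k.+1] elements and equals
   [sg v]. *)
have sub_sg (t : {set 'I_n}) v x : inter A t x -> inter A (sg v) x -> t \subset sg v.
  move=> tx vx; have := small _ _ (inter_setU tx vx); rewrite -(sgk v) => le.
  have /eqP -> : (sg v == t :|: sg v)%SET by rewrite eqEcard le finset.subsetUr.
  exact: finset.subsetUl.
have mkW v (t : {set 'I_n}) : t \subset sg v -> #|t| = k ->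
    exists w : W, val w = (t, cl t (a v)).
  move=> tv tk; have [av _] := Ha v.
  have P : PW (t, cl t (a v)).
    rewrite /PW /= tk eqxx /=; apply/andP; split.
      by apply/asboolP; exists (a v); split=> //; exact: inter_subset av.
    apply/existsP; exists (sg v); rewrite inE tv sgk eqxx !andbT.
    by apply/asboolP; exists (a v).
  by exists (exist (fun x => PW x) _ P).
have mkV (s : {set 'I_n}) x : #|s| = k.+1 -> inter A s x ->
    exists v : V, val v = (s, cl s x).
  move=> sk sx.
  have P : PV (s, cl s x).
    by rewrite /PV /= sk eqxx; apply/asboolP; exists x.
  by exists (exist (fun x => PV x) _ P).
(* Outside the intended arguments [inc] takes an arbitrary value, obtained by deleting an element of
   [sg v]. *)
have /choice[inc Hinc] : forall vt : V * {set 'I_n}, exists w : W,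
    vt.2 \subset sg vt.1 -> #|vt.2| = k -> val w = (vt.2, cl vt.2 (a vt.1)).
  move=> [v t] /=; have [[tv tk]|nt] := EM (t \subset sg v /\ #|t| = k).
    by have [w wE] := mkW v t tv tk; exists w.
  have /card_gt0P[i iv] : (0 < #|sg v|)%N by rewrite sgk.
  have [||w _] := mkW v (sg v :\ i)%SET; first exact: finset.subD1set.
    by have := cardsD1 i (sg v); rewrite iv sgk => -[].
  by exists w => tv tk; case: nt.
have [||||||e [eV ecut]] := @plane_components_graph R V W
    (fun v => inter A (sg v)) (fun w => inter A (tau w)) a d.
- by move=> v; have [] := hcomp (sg v) (or_intror (sgk v)).
- by move=> w; have [] := hcomp (tau w) (or_introl (tauk w)).
- by move=> v; case: (Ha v).
- move=> v v' x vx v'x.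
  have svv : sg v = sg v'.
    apply/eqP; rewrite eqEcard !sgk leqnn andbT.
    exact: sub_sg (square_chain_mem vx) (square_chain_mem v'x).
  have [av va] := Ha v; have [av' va'] := Ha v'.
  apply: val_inj; rewrite (surjective_pairing (val v)) (surjective_pairing (val v')).
  rewrite -/(sg v) -/(sg v') -va -va' -svv; congr (_, _).
  rewrite -svv in av' v'x; apply/((sgcl v).2 _ _ av av').
  by apply: square_chain_trans vx _; exact: square_chain_sym.
(* Classes over one set that meet coincide, so the two k-sets differ. Their union then has exactly
   [k.+1] elements and [x] lies in a class over it. *)
- move=> w w' x ww wx w'x.
  have [dw wd] := Hd w; have [dw' wd'] := Hd w'.
  have tt : tau w != tau w'.
    apply: contraNneq ww => tt; apply/eqP/val_inj.
    rewrite (surjective_pairing (val w)) (surjective_pairing (val w')).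
    rewrite -/(tau w) -/(tau w') -wd -wd' -tt; congr (_, _).
    rewrite -tt in dw' w'x; apply/((taucl w).2 _ _ dw dw').
    by apply: square_chain_trans wx _; exact: square_chain_sym.
  have sx := inter_setU (square_chain_mem wx) (square_chain_mem w'x).
  have sk : #|(tau w :|: tau w')%SET| = k.+1.
    apply/eqP; rewrite eqn_leq (small _ _ sx) -(tauk w) proper_card //.
    rewrite finset.properEneq finset.subsetUl andbT.
    apply: contraNneq tt => E; rewrite eq_sym eqEcard !tauk leqnn andbT E.
    exact: finset.subsetUr.
  have [v vE] := mkV _ _ sk sx; exists v.
  have sv : sg v = (tau w :|: tau w')%SET by rewrite /sg vE.
  have [av va] := Ha v; rewrite -sv in sx.
  apply/((sgcl v).2 _ _ av sx); rewrite va vE /=; by rewrite sv.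
- move=> w v x wx vx.
  have tv := sub_sg _ _ _ (square_chain_mem wx) (square_chain_mem vx).
  apply: square_chain_trans wx _; apply: square_chain_sym.
  exact: square_chain_sub (inter_subset tv) vx.
(* The combinatorial and the topological descriptions of the vertices inside [w] agree. *)
have memE w : [set v | (tau w \subset sg v) && (inc (v, tau w) == w)]%SET =
    [set v | `[< square_chain (inter A (tau w)) (d w) (a v) >]]%SET.
  apply/setP => v; rewrite !inE; have [dw wd] := Hd w; have [av _] := Ha v.
  apply/andP/asboolP => [[tv /eqP iw]|wv].
    apply/((taucl w).2 _ _ dw (inter_subset tv av)).
    by rewrite wd -{1}iw (Hinc (v, tau w) tv (tauk w)).
  have tv := sub_sg _ _ _ (square_chain_mem wv) av.
  split=> //; apply/eqP/val_inj; rewrite (Hinc (v, tau w)) //=.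
  rewrite [RHS]surjective_pairing -wd; congr (_, _).
  by apply/esym/((taucl w).2 _ _ dw (inter_subset tv av)).
have key : (k * #|[set sg v | v in V]%SET| + #|V| <=
    #|[set p : V * V | (p.1 != p.2) && e p.1 p.2]%SET| + #|W|)%N.
  apply: (@component_edge_count V W n k sg tau (fun v t => inc (v, t)) e) => //.
    by move=> v t tv tk; rewrite /tau (Hinc (v, t) tv tk).
  by move=> w; rewrite memE; exact: ecut.
have fV : (fnum k A <= #|[set sg v | v in V]%SET|)%N.
  apply/subset_leq_card/fintype.subsetP => s; rewrite !inE => /andP[/asboolP[x sx] /eqP sk].
  by have [v vE] := mkV _ _ sk sx; apply/imsetP; exists v; rewrite // /sg vE.
(* The spare number is never attained, so each index set carries at most [b] classes. *)
have ord_max_neq (i : 'I_b.+1) : (i < b)%N -> i \in [set~ ord_max]%SET.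
  by rewrite !inE => ib; apply/eqP => E; rewrite E ltnn in ib.
have cardV : (#|V| <= fnum k A * b)%N.
  rewrite -[X in (_ * X)%N](_ : #|[set~ (@ord_max b)]%SET| = b); last by rewrite cardsC1 card_ord.
  rewrite -cardsX -(card_imset _ (@val_inj _ _ V)).
  apply/subset_leq_card/fintype.subsetP => _ /imsetP[v _ ->].
  have [av va] := Ha v; rewrite inE -va ord_max_neq ?andbT; last exact: (sgcl v).1.
  rewrite !inE sgk eqxx andbT; apply/asboolP; by exists (a v).
have cardW : (#|W| <= fnum_ind k.-1 A * b)%N.
  rewrite -[X in (_ * X)%N](_ : #|[set~ (@ord_max b)]%SET| = b); last by rewrite cardsC1 card_ord.
  rewrite -cardsX -(card_imset _ (@val_inj _ _ W)).
  apply/subset_leq_card/fintype.subsetP => _ /imsetP[w _ ->].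
  have [dw wd] := Hd w; rewrite inE -wd ord_max_neq ?andbT; last exact: (taucl w).1.
  have /and3P[_ _ ex] := valP w; rewrite !inE prednK // -/(tau w) tauk eqxx ex !andbT.
  by apply/asboolP; exists (d w).
(* The edge bound [3 * #|V|] in [key] leaves [2 * #|V| + #|W|] on the right. *)
have fin : (k * fnum k A <= 2 * b * fnum k A + b * fnum_ind k.-1 A)%N.
  have := leq_mul (leqnn k) fV; lia.
have kb : 0 < k%:R - 2 * b%:R :> R by rewrite subr_gt0 -natrM ltr_nat.
rewrite mulrAC ler_pdivlMr //.
move: fin; rewrite -(ler_nat R) natrD !natrM; lra.
Qed.
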